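(* Let $f_i$ ($i\in\mathcal V$) and $g_{\{i,j\}}$ ($\{i,j\}\in\mathcal E$) satisfy the following assumptions (all notation is as in the context). (A1) For each $i\in\mathcal V$, $f_i$ is twice continuously differentiable and locally strongly convex, $f_i$ has a minimizer, and $\nabla^2 f_i$ is locally Lipschitz continuous. (A2) For each $\{i,j\}\in\mathcal E$, $g_{\{i,j\}}$ is twice continuously differentiable and locally strongly convex. (A3) For each $i\in\mathcal V$, $x\mapsto f_i(x^* )-f_i(x)-\nabla f_i(x)^T(x^*-x)$ is coercive. Let $\mathbf x^k=[x_1^k;\ldots;x_N^k]$, $k\ge 0$, be generated by the DEAN iteration with step-sizes $0<\alpha_{\{i,j\}}\le\bar\alpha$ for all $\{i,j\}\in\mathcal E$. For each $i\in\mathcal V$, let $$\eta_i=\frac{|\mathcal N_i|L_i\sqrt N\,V(\mathbf x^0)}{\theta_i^2\sum_{\ell\in\mathcal V}\bar\theta_\ell}\ge0,\qquad \tilde\eta_i=\frac{2|\mathcal N_i|}{\theta_i^2}\Bigl(\Theta'_i-\frac{\theta'_i}{2}+\frac{L'_i}{2}\sqrt{\frac{2V(\mathbf x^0)}{\theta_i}}\Bigr)>0.$$ Given $\epsilon>0$, if $$\alpha_{\{i,j\}}<\frac{\epsilon}{\Gamma_{\{i,j\}}}\min\Bigl\{\frac{1}{\eta_i+\tilde\eta_i\epsilon},\ \frac{1}{\eta_j+\tilde\eta_j\epsilon}\Bigr\},\quad\forall\{i,j\}\in\mathcal E,$$ then $\lim_{k\to\infty}\|\mathbf x^k-\mathbf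 x^*\|<\epsilon$, where $\mathbf x^*=[x^*;\ldots;x^*]\in\mathbb R^{nN}$.
   Context: **Network and problem.** $\mathcal G=(\mathcal V,\mathcal E)$ is an undirected connected graph, $\mathcal V=\{1,\dots,N\}$, $N\ge2$, $\mathcal E\subseteq\{\{i,j\}:i,j\in\mathcal V,\ i\ne j\}$ (unordered pairs), and $\mathcal N_i=\{j\in\mathcal V:\{i,j\}\in\mathcal E\}$. Each node $i$ has a function $f_i:\mathbb R^n\to\mathbb R$, and each link $\{i,j\}\in\mathcal E$ has a function $g_{\{i,j\}}:\mathbb R^n\to\mathbb R$. $\|\cdot\|$ is the Euclidean norm (for matrices, the induced spectral norm); $[z_1;\dots;z_N]\in\mathbb R^{nN}$ denotes stacking; $A\succeq B$ means $A-B$ is positive semidefinite; $\operatorname{conv}$ is the convex hull. A twice continuously differentiable $f:\mathbb R^n\to\mathbb R$ is *locally strongly convex* if for every convex compact set $\mathcal C$ there is $\theta_{\mathcal C}>0$ with $\nabla^2 f(x)\succeq\theta_{\mathcal C}I_n$ for all $x\in\mathcal C$. A vector- or matrix-valued function $h$ is *locally Lipschitz continuous* if for every compact $\mathcal C$ in its domain there is $L_{\mathcal C}\ge0$ with $\|h(x)-h(y)\|\le L_{\mathcal C}\|x-y\|$ for all $x,y\in\mathcal C$. Under assumption (A1), each $f_i$ has a unique minimizer $x_i^*\in\mathbb R^n$, and $\min_{x\in\mathbb R^n}\sum_{i\in\mathcal V}f_i(x)$ has a unique optimal solution $x^*$. **DEAN iteration.** Given symmetric link step-sizes $\alpha_{\{i,j\}}>0$,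 set $x_i^0=x_i^*$ for all $i\in\mathcal V$ and, for $k\ge0$ and all $i\in\mathcal V$, $$x_i^{k+1}=x_i^k+(\nabla^2 f_i(x_i^k))^{-1}\sum_{j\in\mathcal N_i}\alpha_{\{i,j\}}\bigl(\nabla g_{\{i,j\}}(x_j^k)-\nabla g_{\{i,j\}}(x_i^k)\bigr).$$ **Lyapunov function.** For $\mathbf x=[x_1;\dots;x_N]\in\mathbb R^{nN}$, $V(\mathbf x)=\sum_{i\in\mathcal V}\bigl(f_i(x^* )-f_i(x_i)-\nabla f_i(x_i)^T(x^*-x_i)\bigr)$. **Constants.** With $\mathbf x^0=[x_1^*;\dots;x_N^*]$, let $\mathcal C_i=\{x\in\mathbb R^n: f_i(x^* )-f_i(x)-\nabla f_i(x)^T(x^*-x)\le V(\mathbf x^0)\}$, which is compact under (A3). Fix: - $\Theta_i,\theta_i\in(0,\infty)$ with $\Theta_iI_n\succeq\nabla^2 f_i(x)\succeq\theta_iI_n$ for all $x\in\operatorname{conv}\mathcal C_i$; - $L_i\in[0,\infty)$ a Lipschitz constant of $\nabla^2 f_i$ on $\operatorname{conv}\mathcal C_i$; - $\bar\Theta_i,\bar\theta_i\in(0,\infty)$ with $\bar\Theta_iI_n\succeq\nabla^2 f_i(x)\succeq\bar\theta_iI_n$ for all $x\in\operatorname{conv}\bigcup_{j\in\mathcal V}\mathcal C_j$; - $\Gamma_{\{i,j\}},\gamma_{\{i,j\}}\in(0,\infty)$ with $\Gamma_{\{i,j\}}I_n\succeq\nabla^2 g_{\{i,j\}}(x)\succeq\gamma_{\{i,j\}}I_n$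 for all $x\in\operatorname{conv}(\mathcal C_i\cup\mathcal C_j)$; - an arbitrary $\bar\alpha>0$, and $\delta_i=\frac{\bar\alpha}{\theta_i}\sum_{j\in\mathcal N_i}\Gamma_{\{i,j\}}\Bigl(\sqrt{2V(\mathbf x^0)/\theta_i}+\sqrt{2V(\mathbf x^0)/\theta_j}\Bigr)$; - $\mathcal C_i'=\operatorname{conv}\{x\in\mathbb R^n:\|x-y\|\le\delta_i \text{ for some } y\in\mathcal C_i\}$ (compact, containing $\operatorname{conv}\mathcal C_i$); - $\Theta_i',\theta_i'\in(0,\infty)$ with $\Theta_i'I_n\succeq\nabla^2 f_i(x)\succeq\theta_i'I_n$ for all $x\in\mathcal C_i'$, and $L_i'\in[0,\infty)$ a Lipschitz constant of $\nabla^2 f_i$ on $\mathcal C_i'$, where $\Theta_i'\ge\Theta_i$, $\theta_i'\le\theta_i$, $L_i'\ge L_i$. *)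

(* Defs.v *)
(* MathComp-Analysis development, over an arbitrary R : realType. *)
From HB Require Import structures.
From mathcomp Require Export all_boot all_order all_algebra.
From mathcomp Require Export all_classical all_reals all_analysis.
Export Order.TTheory GRing.Theory Num.Theory.
Export numFieldNormedType.Exports.
#[export] Set Implicit Arguments.
#[export] Unset Strict Implicit.
#[export] Unset Printing Implicit Defensive.

Global Open Scope classical_set_scope.
Global Open Scope ring_scope.

(* Points of R^n are row vectors, so a linear map acts by v |-> v *m A.  The
   norm `|v| of the library on 'rV[R]_n is the sup norm: it is used only through
   the notions that do not depend on the choice of a norm (differentiability,
   continuity, compactness). *)

Definition dotv (R : realType) (n : nat) (u v : 'rV[R]_n) : R :=
  (u *m v^T) 0 0.

Definition enorm (R : realType) (n : nat) (v : 'rV[R]_n) : R :=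
  Num.sqrt (dotv v v).

(* induced by enorm; acting on rows or on columns gives the same norm *)
Definition specnorm (R : realType) (n : nat) (A : 'M[R]_n) : R :=
  sup [set enorm (v *m A) | v in [set v : 'rV[R]_n | enorm v <= 1]].

Definition psd (R : realType) (n : nat) (A : 'M[R]_n) : Prop :=
  A^T = A /\ forall v : 'rV[R]_n, 0 <= dotv (v *m A) v.

Definition loewner_ge (R : realType) (n : nat) (A B : 'M[R]_n) : Prop :=
  psd (A - B).

Definition grad (R : realType) (n : nat) (f : 'rV[R]_n -> R) (x : 'rV[R]_n) :
  'rV[R]_n := \row_(j < n) 'D_(delta_mx 0 j) f x.

(* the (i, j) entry is the derivative of (grad f) 0 j in the direction i *)
Definition hess (R : realType) (n : nat) (f : 'rV[R]_n -> R) (x : 'rV[R]_n) :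
  'M[R]_n := jacobian (grad f) x.

Definition twice_cont_diff (R : realType) (n : nat) (f : 'rV[R]_n -> R) : Prop :=
  [/\ forall x, differentiable f x,
      forall x, differentiable (grad f) x
    & continuous (hess f)].

Definition locally_strongly_convex (R : realType) (n : nat)
    (f : 'rV[R]_n -> R) : Prop :=
  forall C : set 'rV[R]_n, convex_set C -> compact C ->
    exists2 theta : R, 0 < theta &
      forall x, C x -> loewner_ge (hess f x) theta%:M.

Definition lipschitz_const (R : realType) (n : nat) (h : 'rV[R]_n -> 'M[R]_n)
    (C : set 'rV[R]_n) (L : R) : Prop :=
  0 <= L /\
  forall x y, C x -> C y -> specnorm (h x - h y) <= L * enorm (x - y).

Definition locally_lipschitz (R : realType) (n : nat)
    (h : 'rV[R]_n -> 'M[R]_n) : Prop :=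
  forall C : set 'rV[R]_n, compact C -> exists L : R, lipschitz_const h C L.

Definition is_minimizer (R : realType) (n : nat) (f : 'rV[R]_n -> R)
    (x : 'rV[R]_n) : Prop := forall y, f x <= f y.

Definition coercive (R : realType) (n : nat) (f : 'rV[R]_n -> R) : Prop :=
  forall M : R, exists r : R, forall x, r <= enorm x -> M <= f x.

Definition conv_hull (R : realType) (n : nat) (A : set 'rV[R]_n) :
  set 'rV[R]_n := smallest (@convex_set R 'rV[R]_n) A.

Definition hess_bounds (R : realType) (n : nat) (f : 'rV[R]_n -> R)
    (C : set 'rV[R]_n) (Theta theta : R) : Prop :=
  [/\ 0 < Theta, 0 < theta
    & forall x, C x -> loewner_ge Theta%:M (hess f x) /\
                       loewner_ge (hess f x) theta%:M].

(* A graph on 'I_N is given by its set E of unordered pairs [set i; j]; data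
   indexed by the links are functions on {set 'I_N}, of which only the values
   on E matter. *)

Definition is_graph (N : nat) (E : {set {set 'I_N}}) : Prop :=
  forall e, e \in E -> #|e| = 2%N.

Definition nbr (N : nat) (E : {set {set 'I_N}}) (i : 'I_N) : {set 'I_N} :=
  [set j | [set i; j] \in E]%SET.

Definition connected_graph (N : nat) (E : {set {set 'I_N}}) : Prop :=
  forall i j, connect (fun k l => l \in nbr E k) i j.

(* [x_1; ...; x_N] as a vector of size N * n *)
Definition stack (R : realType) (N n : nat) (x : 'I_N -> 'rV[R]_n) :
  'rV[R]_(\sum_(i < N) n) := \mxrow_(i < N) x i.

Definition bregman (R : realType) (n : nat) (f : 'rV[R]_n -> R)
    (xs x : 'rV[R]_n) : R := f xs - f x - dotv (grad f x) (xs - x).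

Definition lyapunov (R : realType) (N n : nat) (f : 'I_N -> 'rV[R]_n -> R)
    (xs : 'rV[R]_n) (x : 'I_N -> 'rV[R]_n) : R :=
  \sum_(i < N) bregman (f i) xs (x i).

(* The gradients are row vectors, so the inverse Hessian multiplies on the
   right. *)
Definition dean_sequence (R : realType) (N n : nat)
    (E : {set {set 'I_N}}) (f : 'I_N -> 'rV[R]_n -> R)
    (g : {set 'I_N} -> 'rV[R]_n -> R) (alpha : {set 'I_N} -> R)
    (x0 : 'I_N -> 'rV[R]_n) (x : nat -> 'I_N -> 'rV[R]_n) : Prop :=
  (forall i, x 0%N i = x0 i) /\
  forall k i, x k.+1 i = x k i +
    (\sum_(j in nbr E i) alpha [set i; j]%SET *:
       (grad (g [set i; j]%SET) (x k j) - grad (g [set i; j]%SET) (x k i)))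
    *m invmx (hess (f i) (x k i)).

(* The set C_i; xm is the family of the minimizers of the f i, xs the minimizer
   of their sum. *)
Definition sublevel (R : realType) (N n : nat) (f : 'I_N -> 'rV[R]_n -> R)
    (xs : 'rV[R]_n) (xm : 'I_N -> 'rV[R]_n) (i : 'I_N) : set 'rV[R]_n :=
  [set x | bregman (f i) xs x <= lyapunov f xs xm].

(* delta_i, where V0 stands for V(x^0) *)
Definition delta_radius (R : realType) (N : nat) (E : {set {set 'I_N}})
    (V0 alphabar : R) (theta : 'I_N -> R) (Gamma : {set 'I_N} -> R)
    (i : 'I_N) : R :=
  alphabar / theta i *
  \sum_(j in nbr E i) Gamma [set i; j]%SET *
    (Num.sqrt (2 * V0 / theta i) + Num.sqrt (2 * V0 / theta j)).

(* the set C_i' when C = C_i and d = delta_i *)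
Definition enlarged_hull (R : realType) (n : nat) (C : set 'rV[R]_n) (d : R) :
  set 'rV[R]_n := conv_hull [set x | exists2 y, C y & enorm (x - y) <= d].

Definition eta (R : realType) (N : nat) (E : {set {set 'I_N}}) (V0 : R)
    (theta thetabar L : 'I_N -> R) (i : 'I_N) : R :=
  #|nbr E i|%:R * L i * Num.sqrt N%:R * V0 /
  (theta i ^+ 2 * \sum_(l < N) thetabar l).

Definition etatilde (R : realType) (N : nat) (E : {set {set 'I_N}}) (V0 : R)
    (theta Theta' theta' L' : 'I_N -> R) (i : 'I_N) : R :=
  2 * #|nbr E i|%:R / theta i ^+ 2 *
  (Theta' i - theta' i / 2 + L' i / 2 * Num.sqrt (2 * V0 / theta i)).

(* Main.v *)
From HB Require Import structures.
Require Import Defs.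
From mathcomp Require Import ring lra.

(** The iteration makes V a Lyapunov function: with w_ij the difference of the
    gradients of g_ij at x_j and x_i, the symmetry of the graph and the
    cocoercivity of these gradients give a decrease of
    sum_i sum_(j in N_i) alpha_ij |w_ij|^2 / (2 Gamma_ij), while the
    second-order error of the Newton-type update costs at most
    sum_i sum_(j in N_i) alpha_ij^2 etatilde_i |w_ij|^2 / 2.  The net decrease
    forces consensus.  The sum S of the gradients of the f_i vanishes initially
    and would be preserved in continuous time; in discrete time its drift is
    again quadratic in w, and the step-size condition says exactly that
    sqrt(N) V(x^0) / (sum_i thetabar_i) times this drift is at most epsilon
    times the decrease of V.  Summing over the iterations and using the strong
    monotonicity of the sum of the gradients, the distance to x* of the limit
    is at most epsilon (V(x^0) - lim V) / V(x^0), which is less than epsilon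
    unless lim V = 0, in which case the limit is x*. *)

(** * Euclidean norm *)

Section euclidean.
Context (R : realType) (n : nat).
Implicit Types (u v w : 'rV[R]_n) (A : 'M[R]_n) (a : R).

Lemma dotvE u v : dotv u v = \sum_i u 0 i * v 0 i.
Proof. by rewrite /dotv mxE; apply: eq_bigr => i _; rewrite mxE. Qed.

Lemma dotvC u v : dotv u v = dotv v u.
Proof. by rewrite !dotvE; apply: eq_bigr => i _; rewrite mulrC. Qed.

Lemma dotvDl u v w : dotv (u + v) w = dotv u w + dotv v w.
Proof. by rewrite /dotv mulmxDl mxE. Qed.

Lemma dotvNl u w : dotv (- u) w = - dotv u w.
Proof. by rewrite /dotv mulNmx mxE. Qed.

Lemma dotvZl a u w : dotv (a *: u) w = a * dotv u w.
Proof. by rewrite /dotv -scalemxAl mxE. Qed.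

Lemma dotv0l w : dotv 0 w = 0.
Proof. by rewrite /dotv mul0mx mxE. Qed.

Lemma dotvDr u v w : dotv w (u + v) = dotv w u + dotv w v.
Proof. by rewrite dotvC dotvDl !(dotvC w). Qed.

Lemma dotvNr u w : dotv w (- u) = - dotv w u.
Proof. by rewrite dotvC dotvNl (dotvC w). Qed.

Lemma dotvZr a u w : dotv w (a *: u) = a * dotv w u.
Proof. by rewrite dotvC dotvZl (dotvC w). Qed.

Lemma dotv_suml (I : Type) (r : seq I) (P : pred I) (F : I -> 'rV[R]_n) w :
  dotv (\sum_(i <- r | P i) F i) w = \sum_(i <- r | P i) dotv (F i) w.
Proof.
by elim/big_rec2 : _ => [|i a u _ <-]; rewrite ?dotv0l ?dotvDl.
Qed.

Definition dotv_expand := (dotvDl, dotvNl, dotvZl, dotvDr, dotvNr, dotvZr).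

Lemma dotv_ge0 v : 0 <= dotv v v.
Proof. by rewrite dotvE sumr_ge0// => i _; rewrite -expr2 sqr_ge0. Qed.

Lemma dotv_eq0 v : (dotv v v == 0) = (v == 0).
Proof.
apply/idP/eqP => [|->]; last by rewrite dotv0l.
rewrite dotvE psumr_eq0; last by move=> i _; rewrite -expr2 sqr_ge0.
move=> /allP v0; apply/rowP => i; rewrite mxE.
by have := v0 i (mem_index_enum i); rewrite /= mulf_eq0 orbb => /eqP.
Qed.

Lemma enorm_ge0 v : 0 <= enorm v.
Proof. exact: sqrtr_ge0. Qed.

Lemma sqr_enorm v : enorm v ^+ 2 = dotv v v.
Proof. by rewrite sqr_sqrtr// dotv_ge0. Qed.

Lemma enorm_eq0 v : (enorm v == 0) = (v == 0).
Proof. by rewrite -dotv_eq0 -sqr_enorm sqrf_eq0. Qed.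

Lemma enorm0 : enorm (0 : 'rV[R]_n) = 0.
Proof. by apply/eqP; rewrite enorm_eq0. Qed.

Lemma enormZ a v : enorm (a *: v) = `|a| * enorm v.
Proof.
by rewrite /enorm !dotv_expand mulrA -expr2 sqrtrM ?sqr_ge0// sqrtr_sqr.
Qed.

Lemma enormN v : enorm (- v) = enorm v.
Proof. by rewrite -scaleN1r enormZ normrN1 mul1r. Qed.

Lemma enormB u v : enorm (u - v) = enorm (v - u).
Proof. by rewrite -enormN opprB. Qed.

(** For nonzero vectors of norms a and b, expand [0 <= |b u - a v|^2] and divide by [2 a b]. *)
Lemma cauchy_schwarz u v : dotv u v <= enorm u * enorm v.
Proof.
have [->|u0] := eqVneq u 0; first by rewrite dotv0l mulr_ge0// enorm_ge0.
have [->|v0] := eqVneq v 0; first by rewrite dotvC dotv0l mulr_ge0// enorm_ge0.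
have eu : 0 < enorm u by rewrite lt_def enorm_eq0 u0 enorm_ge0.
have ev : 0 < enorm v by rewrite lt_def enorm_eq0 v0 enorm_ge0.
have := dotv_ge0 (enorm v *: u - enorm u *: v).
rewrite !dotv_expand -!sqr_enorm (dotvC v u) => h.
have : 0 <= (enorm u * enorm v) * (enorm u * enorm v - dotv u v) by nra.
by rewrite pmulr_rge0 ?mulr_gt0// subr_ge0.
Qed.

Lemma enormD u v : enorm (u + v) <= enorm u + enorm v.
Proof.
rewrite -(@ler_pXn2r _ 2) ?nnegrE ?addr_ge0 ?enorm_ge0//.
rewrite sqr_enorm !dotv_expand (dotvC v u) -!sqr_enorm.
have := cauchy_schwarz u v; nra.
Qed.

Lemma enorm_dist u v : `|enorm u - enorm v| <= enorm (u - v).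
Proof.
rewrite ler_norml; apply/andP; split.
  by have := enormD (v - u) u; rewrite subrK enormB; lra.
by have := enormD (u - v) v; rewrite subrK; lra.
Qed.

Lemma enorm_sum (I : Type) (r : seq I) (P : pred I) (F : I -> 'rV[R]_n) :
  enorm (\sum_(i <- r | P i) F i) <= \sum_(i <- r | P i) enorm (F i).
Proof.
elim/big_ind2 : _ => [|u a v b ua vb|//]; first by rewrite enorm0.
by rewrite (le_trans (enormD _ _))// lerD.
Qed.

(** Makes the supremum in [specnorm] meaningful: [v *m A] combines the rows of A with coefficients
    that are at most the norm of v in absolute value. *)
Lemma enorm_mulmx_bounded A :
  exists M : R, forall v, enorm v <= 1 -> enorm (v *m A) <= M.
Proof.
exists (\sum_j enorm (\row_k (A j k))) => v v1.
rewrite mulmx_sum_row (le_trans (enorm_sum _ _ _))// ler_sum// => i _.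
rewrite enormZ (_ : row i A = \row_k A i k); last first.
  by apply/rowP => k; rewrite !mxE.
rewrite ler_piMl ?enorm_ge0//.
rewrite (le_trans _ v1)// -sqrtr_sqr ler_wsqrtr//.
rewrite dotvE (bigD1 i)//= -expr2 lerDl sumr_ge0// => j _.
by rewrite -expr2 sqr_ge0.
Qed.

Lemma enorm_mulmx_le v A : enorm (v *m A) <= specnorm A * enorm v.
Proof.
have [->|v0] := eqVneq v 0; first by rewrite mul0mx !enorm0 mulr0.
have ev : 0 < enorm v by rewrite lt_def enorm_eq0 v0 enorm_ge0.
rewrite -ler_pdivrMr// mulrC.
have -> : (enorm v)^-1 * enorm (v *m A) = enorm (((enorm v)^-1 *: v) *m A).
  by rewrite -scalemxAl enormZ ger0_norm ?invr_ge0 ?ltW.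
apply: ub_le_sup.
  have [M HM] := enorm_mulmx_bounded A.
  by exists M => _ [w /= w1 <-]; exact: HM.
exists ((enorm v)^-1 *: v) => //=.
by rewrite enormZ ger0_norm ?invr_ge0 ?enorm_ge0// mulVf ?gt_eqF.
Qed.

(** Both sides are double sums over P; termwise, the inner product of [F i] and [F j] is at most the
    mean of their squared norms. *)
Lemma sqr_enorm_sum (I : finType) (P : {set I}) (F : I -> 'rV[R]_n) :
  enorm (\sum_(i in P) F i) ^+ 2 <= #|P|%:R * \sum_(i in P) enorm (F i) ^+ 2.
Proof.
rewrite sqr_enorm dotv_suml.
have -> : \sum_(i in P) dotv (F i) (\sum_(j in P) F j) =
    \sum_(i in P) \sum_(j in P) dotv (F i) (F j).
  apply: eq_bigr => i _; rewrite dotvC dotv_suml.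
  by apply: eq_bigr => j _; rewrite dotvC.
have -> : #|P|%:R * \sum_(i in P) enorm (F i) ^+ 2 =
    \sum_(i in P) \sum_(j in P) (enorm (F i) ^+ 2 + enorm (F j) ^+ 2) / 2.
  set T := \sum_(i in P) enorm (F i) ^+ 2.
  rewrite (eq_bigr (fun i => #|P|%:R * enorm (F i) ^+ 2 / 2 + T / 2)).
    by rewrite big_split/= sumr_const -mulr_suml -mulr_sumr -/T -mulr_natl; field.
  by move=> i _; rewrite -mulr_suml big_split/= sumr_const -/T -mulr_natl; field.
rewrite ler_sum// => i _; rewrite ler_sum// => j _.
have := cauchy_schwarz (F i) (F j).
have := sqr_ge0 (enorm (F i) - enorm (F j)); nra.
Qed.

End euclidean.

(** * Calculus along segments *)

Section segment_calculus.
Context (R : realType) (n : nat).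
Implicit Types (x y u v w : 'rV[R]_n) (C : set 'rV[R]_n) (f : 'rV[R]_n -> R).

Lemma convex_segment C x v (t : R) : convex_set C -> C x -> C (x + v) ->
  0 <= t <= 1 -> C (x + t *: v).
Proof.
move=> cC Cx Cy /andP[t0 t1].
have := cC (x + v) x (Itv01 t0 t1) (mem_set Cy) (mem_set Cx).
rewrite inE; congr C.
rewrite /conv/= /unstable.onem scalerDr scalerBl scale1r.
by rewrite addrC addrA subrK.
Qed.

Lemma convex_conv_hull C : convex_set (conv_hull C).
Proof.
move=> x y l; rewrite !inE => xC yC D [cD CD].
have := cD x y l (mem_set (xC D (conj cD CD))) (mem_set (yC D (conj cD CD))).
by rewrite inE.
Qed.

Lemma conv_hull_sub C : C `<=` conv_hull C.
Proof. exact: sub_gen_smallest. Qed.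

Lemma is_derive_line (W : normedModType R) (F : 'rV[R]_n -> W) x v (t : R) :
  differentiable F (x + t *: v) ->
  is_derive t 1 (fun s : R => F (x + s *: v)) ('D_v F (x + t *: v)).
Proof.
move=> dF; have dl : is_diff t (fun s : R => x + s *: v) (fun s : R => s *: v).
  by apply: is_diff_eq; rewrite add0r.
have dc := is_diff_comp dl (differentiableP dF).
apply: DeriveDef.
  exact/derivable1_diffP/ex_diff.
by rewrite deriveE ?diff_val/= ?scale1r ?deriveE//; exact: ex_diff.
Qed.

Lemma dotv_grad f x v : differentiable f x -> dotv (grad f x) v = 'D_v f x.
Proof.
move=> df; rewrite deriveE// [in RHS](row_sum_delta v) linear_sum dotvE.
by apply: eq_bigr => i _; rewrite linearZ/= mxE deriveE// mulrC.
Qed.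

(** Differentiability is first read off the coordinates; it gives the continuity under which a
    linear map is its own differential. *)
Lemma is_diff_dotv w x : is_diff x (fun u => dotv u w) (fun u => dotv u w).
Proof.
have dd y : differentiable (fun u => dotv u w) y.
  rewrite (_ : (fun u => _) =
      \sum_(i < n) (w 0 i *: (fun u : 'rV[R]_n => u 0 i))).
    apply: differentiable_sum => i; apply: differentiableZ.
    exact: differentiable_coord.
  apply/funext => u; rewrite dotvE fct_sumE; apply: eq_bigr => i _.
  by rewrite mulrC.
have dlin : linear (fun u => dotv u w : R^o).
  by move=> a u v; rewrite dotvDl dotvZl.
pose dM := GRing.isLinear.Build _ _ _ _ _ dlin.
pose dL : {linear 'rV[R]_n -> R^o} := HB.pack (fun u => dotv u w : R^o) dM.
apply: DiffDef => //; apply: (@diff_lin _ _ _ dL).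
by move=> y; exact: differentiable_continuous.
Qed.

Lemma is_derive_grad_line f x v w (t : R) :
  differentiable (grad f) (x + t *: v) ->
  is_derive t 1 (fun s : R => dotv (grad f (x + s *: v)) w)
    (dotv (v *m hess f (x + t *: v)) w).
Proof.
move=> dg; rewrite -deriveEjacobian//.
have dc := is_diff_comp (differentiableP dg) (is_diff_dotv w _).
have -> : dotv ('D_v (grad f) (x + t *: v)) w =
    'D_v (fun y => dotv (grad f y) w) (x + t *: v).
  by rewrite !deriveE ?diff_val//; exact: ex_diff.
by apply: is_derive_line; exact: ex_diff.
Qed.

Lemma is_derive_fline f x v (t : R) : differentiable f (x + t *: v) ->
  is_derive t 1 (fun s : R => f (x + s *: v)) (dotv (grad f (x + t *: v)) v).
Proof. by move=> df; rewrite dotv_grad//; exact: is_derive_line. Qed.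

(** One-sided mean value inequality. Vector estimates are reduced to it by pairing with a fixed
    vector, and second-order ones by subtracting a quadratic in t and taking [M = 0]. *)
Lemma le_increment (phi dphi : R -> R) (M : R) :
  (forall t : R, 0 <= t <= 1 -> is_derive t 1 phi (dphi t)) ->
  (forall t, 0 <= t <= 1 -> dphi t <= M) -> phi 1 - phi 0 <= M.
Proof.
move=> dphiP leM.
have [|||c c01 ->] := @MVT R phi dphi 0 1.
- exact: ltr01.
- by move=> t /itvP t01; apply: dphiP; rewrite !t01.
- apply: derivable_within_continuous => t /itvP t01.
  have ? : is_derive t 1 phi (dphi t) by apply: dphiP; rewrite !t01.
  exact: ex_derive.
- by rewrite subr0 mulr1 leM// !(itvP c01).
Qed.

End segment_calculus.

(** * Consequences of Hessian bounds *)

Section hessian_bounds.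
Context (R : realType) (n : nat).
Implicit Types (x y u v w : 'rV[R]_n) (C : set 'rV[R]_n) (f : 'rV[R]_n -> R).

Lemma loewner_ge_scalarl (a : R) (H : 'M[R]_n) v :
  loewner_ge a%:M H -> dotv (v *m H) v <= a * dotv v v.
Proof.
move=> [_ /(_ v)]; rewrite mulmxBr mul_mx_scalar !dotv_expand; lra.
Qed.

Lemma loewner_ge_scalarr (a : R) (H : 'M[R]_n) v :
  loewner_ge H a%:M -> a * dotv v v <= dotv (v *m H) v.
Proof.
move=> [_ /(_ v)]; rewrite mulmxBr mul_mx_scalar !dotv_expand; lra.
Qed.

Lemma loewner_ge_sym (a : R) (H : 'M[R]_n) : loewner_ge H a%:M -> H^T = H.
Proof.
move=> [+ _]; rewrite linearB/= tr_scalar_mx => /eqP.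
by rewrite subr_eq subrK => /eqP.
Qed.

Lemma dotv_mulmx_sym (H : 'M[R]_n) u v :
  H^T = H -> dotv (u *m H) v = dotv (v *m H) u.
Proof. by move=> Hs; rewrite [RHS]dotvC /dotv trmx_mul Hs mulmxA. Qed.

(** Positivity of the quadratic form makes H injective, hence invertible. With [d = u *m invmx H],
    one has [a |d|^2 <= d H d = u d <= |u| |d|]. *)
Lemma enorm_invmx_le (a : R) (H : 'M[R]_n) u : 0 < a -> loewner_ge H a%:M ->
  [/\ u *m invmx H *m H = u & enorm (u *m invmx H) <= enorm u / a].
Proof.
move=> a0 Ha.
have Hu : H \in unitmx.
  rewrite -row_free_unit; apply: inj_row_free => v vH.
  have := loewner_ge_scalarr v Ha; rewrite vH dotv0l pmulr_rle0// => v0.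
  by apply/eqP; rewrite -dotv_eq0 eq_le v0 dotv_ge0.
split; first by rewrite -mulmxA mulVmx// mulmx1.
set d := u *m _.
have dH : d *m H = u by rewrite /d -mulmxA mulVmx// mulmx1.
have := loewner_ge_scalarr d Ha; rewrite dH -sqr_enorm => h.
have h2 := le_trans h (cauchy_schwarz u d).
rewrite ler_pdivlMr//.
have [->|d0] := eqVneq (enorm d) 0; first by rewrite mul0r enorm_ge0.
have ed : 0 < enorm d by rewrite lt_def d0 enorm_ge0.
rewrite -(ler_pM2r ed); nra.
Qed.

(** The quadratic form of H is nonnegative at [c v - u]; expand and divide by 2c. *)
Lemma dotv_mulmx_am_gm (a : R) (H : 'M[R]_n) u v :
  0 < a -> loewner_ge H a%:M -> forall c : R, 0 < c ->
  dotv (v *m H) u <= dotv (v *m H) v * (c / 2) + dotv (u *m H) u / (2 * c).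
Proof.
move=> a0 Ha c c0.
have := loewner_ge_scalarr (c *: v - u) Ha.
rewrite mulmxBl -scalemxAl !dotv_expand.
rewrite (dotv_mulmx_sym u v (loewner_ge_sym Ha)) => h.
have h0 : 0 <= dotv (c *: v - u) (c *: v - u) by exact: dotv_ge0.
have {}h : 0 <= c * (c * dotv (v *m H) v) - 2 * (c * dotv (v *m H) u) +
    dotv (u *m H) u.
  apply: (le_trans (mulr_ge0 (ltW a0) h0)); rewrite !dotv_expand; lra.
rewrite -(ler_pM2l (_ : 0 < 2 * c)); last by rewrite mulr_gt0.
rewrite (_ : 2 * c * (_ + _) =
  c * (c * dotv (v *m H) v) + dotv (u *m H) u); first lra.
by field; rewrite gt_eqF.
Qed.

Lemma grad_increment_le f x v w (M : R) :
  (forall y, differentiable (grad f) y) ->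
  (forall t : R, 0 <= t <= 1 -> dotv (v *m hess f (x + t *: v)) w <= M) ->
  dotv (grad f (x + v) - grad f x) w <= M.
Proof.
move=> dg hM.
have := @le_increment R (fun s => dotv (grad f (x + s *: v)) w) _ M
  (fun t _ => @is_derive_grad_line R n f x v w t (dg _)) hM.
by rewrite scale1r scale0r addr0 !dotv_expand.
Qed.

Lemma grad_increment_ge f x v w (M : R) :
  (forall y, differentiable (grad f) y) ->
  (forall t : R, 0 <= t <= 1 -> M <= dotv (v *m hess f (x + t *: v)) w) ->
  M <= dotv (grad f (x + v) - grad f x) w.
Proof.
move=> dg hM; rewrite -lerN2 -dotvNr; apply: grad_increment_le => // t t01.
by rewrite dotvNr lerN2 hM.
Qed.

Lemma grad_strongly_monotone f C (Theta theta : R) x y : convex_set C ->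
  (forall z, differentiable (grad f) z) -> hess_bounds f C Theta theta ->
  C x -> C y ->
  theta * dotv (y - x) (y - x) <= dotv (grad f y - grad f x) (y - x).
Proof.
move=> cC dg [_ _ hb] Cx Cy.
have xy : x + (y - x) = y by rewrite addrC subrK.
have := @grad_increment_ge f x (y - x) (y - x) _ dg; rewrite xy => mono.
apply: mono => t t01.
have /hb[_] : C (x + t *: (y - x)) by apply: convex_segment; rewrite ?xy.
exact: loewner_ge_scalarr.
Qed.

(** Cocoercivity on a convex set only, so the usual argument through a minimization over the whole
    space is replaced by one mean value inequality with a well chosen test vector. *)
Lemma grad_cocoercive f C (Theta theta : R) x y : convex_set C ->
  (forall z, differentiable (grad f) z) -> hess_bounds f C Theta theta ->
  C x -> C y ->
  enorm (grad f y - grad f x) ^+ 2 <= Theta * dotv (grad f y - grad f x) (y - x).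
Proof.
move=> cC dg [Th0 theta0 hb] Cx Cy.
set w := grad f y - grad f x; set v := y - x.
have xy : x + v = y by rewrite addrC subrK.
(* With c = Theta in [dotv_mulmx_am_gm], the terms in [v H v] cancel against this test vector,
   leaving [w H w / (2 Theta) <= |w|^2 / 2]. *)
have := @grad_increment_le f x v (w - (Theta / 2) *: v) (dotv w w / 2) dg.
rewrite xy -/w => h; clearbody w v; rewrite sqr_enorm.
suff : dotv w (w - (Theta / 2) *: v) <= dotv w w / 2 by rewrite !dotv_expand; lra.
apply: h => t t01.
have [hb1 hb2] : loewner_ge Theta%:M (hess f (x + t *: v)) /\
    loewner_ge (hess f (x + t *: v)) theta%:M.
  by apply: hb; apply: convex_segment; rewrite ?xy.
have := dotv_mulmx_am_gm w v theta0 hb2 Th0.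
have := loewner_ge_scalarl w hb1.
rewrite !dotv_expand; set p := dotv (w *m _) w; set q := dotv w w => h1 h2.
have : p / (2 * Theta) <= q / 2.
  rewrite ler_pdivrMr ?mulr_gt0//; lra.
lra.
Qed.

Lemma grad_lipschitz f C (Theta theta : R) x y : convex_set C ->
  (forall z, differentiable (grad f) z) -> hess_bounds f C Theta theta ->
  C x -> C y -> enorm (grad f y - grad f x) <= Theta * enorm (y - x).
Proof.
move=> cC dg hb Cx Cy; have [Th0 _ _] := hb.
have := grad_cocoercive cC dg hb Cx Cy.
set w := grad f y - grad f x => h.
have [->|w0] := eqVneq (enorm w) 0; first by rewrite mulr_ge0 ?enorm_ge0// ltW.
have ew : 0 < enorm w by rewrite lt_def w0 enorm_ge0.
have := ler_wpM2l (ltW Th0) (cauchy_schwarz w (y - x)).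
by move=> cs; rewrite -(ler_pM2l ew); lra.
Qed.

Lemma grad_expansive f C (Theta theta : R) x y : convex_set C ->
  (forall z, differentiable (grad f) z) -> hess_bounds f C Theta theta ->
  C x -> C y -> theta * enorm (y - x) <= enorm (grad f y - grad f x).
Proof.
move=> cC dg hb Cx Cy.
have := grad_strongly_monotone cC dg hb Cx Cy.
rewrite -sqr_enorm => h.
have [->|w0] := eqVneq (enorm (y - x)) 0; first by rewrite mulr0 enorm_ge0.
have ew : 0 < enorm (y - x) by rewrite lt_def w0 enorm_ge0.
have := cauchy_schwarz (grad f y - grad f x) (y - x).
by move=> cs; rewrite -(ler_pM2r ew); lra.
Qed.

Lemma is_derive_quad (a b t : R) :
  is_derive t 1 (fun s : R => s * a + s ^+ 2 * b) (a + 2 * t * b).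
Proof.
have h1 : is_derive t 1 (a \*: (@idfun R)) (a *: 1) by apply: is_deriveZ.
have h2 : is_derive t 1 (b \*: ((@idfun R) ^+ 2))
    (b *: ((2%:R * idfun t ^+ 1) *: 1)).
  by apply: is_deriveZ; apply: is_deriveX.
have h := is_deriveD h1 h2.
have -> : (fun s : R => s * a + s ^+ 2 * b) =
    a \*: (@idfun R) + b \*: ((@idfun R) ^+ 2).
  by apply/funext => s /=; rewrite mulrC (mulrC _ b).
apply: is_derive_eq.
by rewrite /GRing.scale/=; ring.
Qed.

(** Along the segment, f minus the quadratic with the same slope at x and curvature [Theta |v|^2]
    has a nonpositive derivative, because the gradient increment over a length t is at most
    [t Theta |v|^2] in the direction v. *)
Lemma bregman_le f C (Theta theta : R) x y : convex_set C ->
  (forall z, differentiable f z) -> (forall z, differentiable (grad f) z) ->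
  hess_bounds f C Theta theta -> C x -> C y ->
  bregman f y x <= Theta / 2 * enorm (y - x) ^+ 2.
Proof.
move=> cC df dg [_ _ hb] Cx Cy; rewrite /bregman sqr_enorm.
set v := y - x; have xy : x + v = y by rewrite addrC subrK.
clearbody v; have dphi (t : R) := is_deriveB (@is_derive_fline R n f x v t (df _))
  (is_derive_quad (dotv (grad f x) v) (Theta / 2 * dotv v v) t).
have := le_increment (fun t _ => dphi t) (M := 0).
rewrite /= !fctE scale1r scale0r addr0 xy => h.
suff: f y - (1 * dotv (grad f x) v + 1 ^+ 2 * (Theta / 2 * dotv v v)) -
  (f x - (0 * dotv (grad f x) v + 0 ^+ 2 * (Theta / 2 * dotv v v))) <= 0 by lra.
apply: h => t /andP[t0 t1].
have : dotv (grad f (x + t *: v) - grad f x) v <= t * (Theta * dotv v v).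
  apply: grad_increment_le => // s /andP[s0 s1].
  rewrite -scalemxAl dotvZl ler_wpM2l// loewner_ge_scalarl//.
  rewrite scalerA; have [] // := hb (x + (s * t) *: v).
  by apply: convex_segment; rewrite ?xy// mulr_ge0//= mulr_ile1.
rewrite !dotv_expand; lra.
Qed.

Lemma bregman_ge f C (Theta theta : R) x y : convex_set C ->
  (forall z, differentiable f z) -> (forall z, differentiable (grad f) z) ->
  hess_bounds f C Theta theta -> C x -> C y ->
  theta / 2 * enorm (y - x) ^+ 2 <= bregman f y x.
Proof.
move=> cC df dg [_ _ hb] Cx Cy; rewrite /bregman sqr_enorm.
set v := y - x; have xy : x + v = y by rewrite addrC subrK.
clearbody v; have dphi (t : R) := is_deriveB
  (is_derive_quad (dotv (grad f x) v) (theta / 2 * dotv v v) t)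
  (@is_derive_fline R n f x v t (df _)).
have := le_increment (fun t _ => dphi t) (M := 0).
rewrite /= !fctE scale1r scale0r addr0 xy => h.
suff: 1 * dotv (grad f x) v + 1 ^+ 2 * (theta / 2 * dotv v v) - f y -
  (0 * dotv (grad f x) v + 0 ^+ 2 * (theta / 2 * dotv v v) - f x) <= 0 by lra.
apply: h => t /andP[t0 t1].
have : t * (theta * dotv v v) <= dotv (grad f (x + t *: v) - grad f x) v.
  apply: grad_increment_ge => // s /andP[s0 s1].
  rewrite -scalemxAl dotvZl ler_wpM2l// loewner_ge_scalarr//.
  rewrite scalerA; have [] // := hb (x + (s * t) *: v).
  by apply: convex_segment; rewrite ?xy// mulr_ge0//= mulr_ile1.
rewrite !dotv_expand; lra.
Qed.

(** Pairing with the remainder w itself gives [|w|^2 <= (L / 2) |d|^2 |w|], from which one factor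
    |w| is cancelled. *)
Lemma grad_remainder f C (L : R) x d : convex_set C ->
  (forall z, differentiable (grad f) z) -> lipschitz_const (hess f) C L ->
  C x -> C (x + d) ->
  enorm (grad f (x + d) - grad f x - d *m hess f x) <= L / 2 * enorm d ^+ 2.
Proof.
move=> cC dg [L0 hL] Cx Cy.
(* The test vector is kept abstract: the derivative along the segment is taken with w constant. *)
have [w Ew] : exists w, w = grad f (x + d) - grad f x - d *m hess f x by eexists.
rewrite -Ew.
have dphi (t : R) := is_deriveB (@is_derive_grad_line R n f x d w t (dg _))
  (is_derive_quad (dotv (d *m hess f x) w) (L / 2 * enorm d ^+ 2 * enorm w) t).
have := le_increment (fun t _ => dphi t) (M := 0).
rewrite /= !fctE scale1r scale0r addr0 => h.
have {h} : dotv (grad f (x + d)) w -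
  (1 * dotv (d *m hess f x) w + 1 ^+ 2 * (L / 2 * enorm d ^+ 2 * enorm w)) -
  (dotv (grad f x) w - (0 * dotv (d *m hess f x) w +
     0 ^+ 2 * (L / 2 * enorm d ^+ 2 * enorm w))) <= 0.
  apply: h => t t01; have /andP[t0 t1] := t01.
  have : dotv (d *m (hess f (x + t *: d) - hess f x)) w <=
      L * (t * enorm d) * enorm d * enorm w.
    apply: (le_trans (cauchy_schwarz _ _)); rewrite ler_wpM2r ?enorm_ge0//.
    apply: (le_trans (enorm_mulmx_le _ _)); rewrite ler_wpM2r ?enorm_ge0//.
    have := hL _ _ (convex_segment cC Cx Cy t01) Cx.
    rewrite (_ : x + t *: d - x = t *: d) ?enormZ ?ger0_norm//.
    by rewrite addrC addKr.
  have key (p q ed ew : R) : p - q <= L * (t * ed) * ed * ew ->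
      p - (q + 2 * t * (L / 2 * ed ^+ 2 * ew)) <= 0 by lra.
  by rewrite mulmxBr dotvDl dotvNl; exact: key.
move=> h.
have {}h : dotv w w <= L / 2 * enorm d ^+ 2 * enorm w.
  have key (p q r ed ew : R) :
      p - (1 * q + 1 ^+ 2 * (L / 2 * ed ^+ 2 * ew)) -
      (r - (0 * q + 0 ^+ 2 * (L / 2 * ed ^+ 2 * ew))) <= 0 ->
      p - r - q <= L / 2 * ed ^+ 2 * ew by lra.
  by rewrite {1}Ew !dotvDl !dotvNl; exact: key h.
have [->|w0] := eqVneq (enorm w) 0.
  by rewrite mulr_ge0 ?divr_ge0 ?exprn_ge0 ?enorm_ge0.
have ew : 0 < enorm w by rewrite lt_def w0 enorm_ge0.
by rewrite -(ler_pM2r ew) (le_trans _ h)// -sqr_enorm expr2.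
Qed.

End hessian_bounds.

(** * First-order optimality and gradients of sums *)

Section minimizers.
Context (R : realType) (n : nat).
Implicit Types (x : 'rV[R]_n) (f : 'rV[R]_n -> R).

Lemma grad_minimizer f x :
  (forall z, differentiable f z) -> is_minimizer f x -> grad f x = 0.
Proof.
move=> df fx; apply/rowP => j; rewrite !mxE.
have dl (t : R) := @is_derive_line R n _ f x (delta_mx 0 j) t (df _).
have d0 : is_derive (0 : R) 1 (fun s : R => f (x + s *: delta_mx 0 j)) 0.
  apply: (@derive1_at_min R _ (-1) 1) => [|t _||t _].
  - lra.
  - exact: ex_derive.
  - by rewrite in_itv/=; apply/andP; split; lra.
  - by rewrite scale0r addr0.
have := @derive_val _ _ _ _ _ _ _ (dl 0); rewrite scale0r addr0 => <-.
exact: derive_val.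
Qed.

Lemma grad_sum (N : nat) (f : 'I_N -> 'rV[R]_n -> R) x :
  (forall i, differentiable (f i) x) ->
  grad (fun y => \sum_(i < N) f i y) x = \sum_(i < N) grad (f i) x.
Proof.
move=> df; apply/rowP => j; rewrite mxE summxE.
rewrite (_ : (fun y => _) = \sum_(i < N) f i); last first.
  by apply/funext => y; rewrite fct_sumE.
rewrite derive_sum; last by move=> i; apply: diff_derivable.
by apply: eq_bigr => i _; rewrite mxE.
Qed.

End minimizers.

(** * Norms of stacked vectors *)

Section stacking.
Context (R : realType) (N n : nat).
Implicit Types (x y : 'I_N -> 'rV[R]_n).

Lemma stackB x y : stack x - stack y = stack (fun i => x i - y i).
Proof. by rewrite /stack -mxrowB. Qed.

Lemma sqr_enorm_stack x : enorm (stack x) ^+ 2 = \sum_(i < N) enorm (x i) ^+ 2.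
Proof.
rewrite sqr_enorm /dotv /stack tr_mxrow mul_mxrow_mxcol summxE.
by apply: eq_bigr => i _; rewrite sqr_enorm.
Qed.

Lemma enorm_stack_const (v : 'rV[R]_n) :
  enorm (stack (fun=> v) : 'rV_(\sum_(i < N) n)) = Num.sqrt N%:R * enorm v.
Proof.
apply/eqP; rewrite -(@eqrXn2 _ 2) ?mulr_ge0 ?enorm_ge0 ?sqrtr_ge0//.
rewrite sqr_enorm_stack sumr_const card_ord exprMn (@sqr_sqrtr _ N%:R)//.
by rewrite mulr_natl.
Qed.

Lemma enorm_stack_le x : enorm (stack x) <= \sum_(i < N) enorm (x i).
Proof.
rewrite -(@ler_pXn2r _ 2) ?nnegrE ?sumr_ge0 ?enorm_ge0//; last first.
  by move=> i _; exact: enorm_ge0.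
rewrite sqr_enorm_stack expr2 mulr_suml ler_sum// => i _.
rewrite expr2 ler_wpM2l ?enorm_ge0// (bigD1 i)//= lerDl sumr_ge0// => j _.
exact: enorm_ge0.
Qed.

End stacking.

(** * Bregman divergence along the move of a single node *)

Section node.
Context (R : realType) (n : nat) (f : 'rV[R]_n -> R) (xs : 'rV[R]_n).
Hypothesis df : forall z, differentiable f z.
Hypothesis dgf : forall z, differentiable (grad f) z.

(** Three-point identity of Bregman divergences: it splits the change of one term of V into a
    second-order part and an inner product with the gradient increment. *)
Lemma bregman_three_points (x y : 'rV[R]_n) : bregman f xs y - bregman f xs x =
  bregman f x y + dotv (grad f y - grad f x) (x - xs).
Proof. by rewrite /bregman !dotv_expand; ring. Qed.

(** In the three-point identity, the divergence between x and x + d is quadratic in d, and the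
    gradient increment is its linearization up to the remainder of [grad_remainder], paired with a
    vector of norm at most rho. *)
Lemma bregman_step (C : set 'rV[R]_n) (Theta theta L rho : R) (x d : 'rV[R]_n) :
  convex_set C -> hess_bounds f C Theta theta -> theta <= Theta ->
  lipschitz_const (hess f) C L -> C x -> C (x + d) -> enorm (x - xs) <= rho ->
  bregman f xs (x + d) <= bregman f xs x + dotv (d *m hess f x) (x - xs) +
    (Theta - theta / 2 + L / 2 * rho) * enorm d ^+ 2.
Proof.
move=> cC hb thTh hL Cx Cd xrho; rewrite -subr_le0.
have L0 := hL.1.
have h1 := bregman_le cC df dgf hb Cd Cx.
have h2 := grad_remainder cC dgf hL Cx Cd.
have h3 := bregman_three_points x (x + d).
rewrite (_ : x - (x + d) = - d) ?enormN in h1; last first.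
  by rewrite opprD addrA subrr add0r.
set r := grad f (x + d) - grad f x - d *m hess f x in h2.
have h4 : dotv r (x - xs) <= L / 2 * enorm d ^+ 2 * rho.
  by rewrite (le_trans (cauchy_schwarz _ _))// ler_pM ?enorm_ge0.
have h5 : dotv (grad f (x + d) - grad f x) (x - xs) =
    dotv r (x - xs) + dotv (d *m hess f x) (x - xs).
  by rewrite -dotvDl subrK.
rewrite h5 in h3.
(* The estimate comes with Theta / 2; it is weakened to [Theta - theta / 2], the constant in
   [etatilde], using [theta <= Theta]. *)
have key (B B' B'' a b e rh : R) : B' - B = B'' + (a + b) ->
    B'' <= Theta / 2 * e ^+ 2 -> a <= L / 2 * e ^+ 2 * rh ->
    B' - (B + b + (Theta - theta / 2 + L / 2 * rh) * e ^+ 2) <= 0.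
  have := mulr_ge0 (_ : 0 <= Theta - theta) (sqr_ge0 e).
  by rewrite subr_ge0 => /(_ thTh); lra.
exact: key h3 h1 h4.
Qed.

End node.

(** * One step of the iteration *)

(** Compare the two bounds on a unit vector, which exists since n is positive. *)
Lemma hess_bounds_le (R : realType) (n : nat) (f : 'rV[R]_n -> R)
    (C : set 'rV[R]_n) (Theta theta : R) x :
  (0 < n)%N -> hess_bounds f C Theta theta -> C x -> theta <= Theta.
Proof.
case: n f C x => // n f C x _ [_ _ hb] /hb[h1 h2].
pose v : 'rV[R]_n.+1 := delta_mx 0 0.
have v1 : dotv v v = 1.
  rewrite dotvE (bigD1 0)//= !mxE eqxx mulr1 big1 ?addr0// => i i0.
  by rewrite !mxE (negbTE i0) mulr0.
have := le_trans (loewner_ge_scalarr v h2) (loewner_ge_scalarl v h1).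
by rewrite v1 !mulr1.
Qed.

Lemma bregmanxx (R : realType) (n : nat) (f : 'rV[R]_n -> R) x : bregman f x x = 0.
Proof. by rewrite /bregman !subrr dotvC dotv0l subr0. Qed.

Lemma nbr_sym (N : nat) (E : {set {set 'I_N}}) i j :
  (j \in nbr E i) = (i \in nbr E j).
Proof. by rewrite !inE finset.setUC. Qed.

Lemma exchange_nbr (V : nmodType) (N : nat) (E : {set {set 'I_N}})
    (F : 'I_N -> 'I_N -> V) :
  \sum_(i < N) \sum_(j in nbr E i) F i j = \sum_(i < N) \sum_(j in nbr E i) F j i.
Proof.
rewrite (exchange_big_dep xpredT)//=.
by apply: eq_bigr => i _; apply: eq_bigl => j; rewrite nbr_sym.
Qed.

(** One iteration as a function of the state, so that the one-step estimates can be stated for an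
    arbitrary state in the sublevel sets. *)
Definition dean_map (R : realType) (N n : nat) (E : {set {set 'I_N}})
    (f : 'I_N -> 'rV[R]_n -> R) (g : {set 'I_N} -> 'rV[R]_n -> R)
    (alpha : {set 'I_N} -> R) (x : 'I_N -> 'rV[R]_n) (i : 'I_N) : 'rV[R]_n :=
  x i + (\sum_(j in nbr E i) alpha [set i; j]%SET *:
      (grad (g [set i; j]%SET) (x j) - grad (g [set i; j]%SET) (x i)))
    *m invmx (hess (f i) (x i)).

Section dean_step.
Context (R : realType) (N n : nat) (E : {set {set 'I_N}})
  (f : 'I_N -> 'rV[R]_n -> R) (g : {set 'I_N} -> 'rV[R]_n -> R)
  (xs : 'rV[R]_n) (V0 alphabar : R)
  (Theta theta L Theta' theta' L' : 'I_N -> R)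
  (Gamma gamma alpha : {set 'I_N} -> R).

Let C i : set 'rV[R]_n := [set x | bregman (f i) xs x <= V0].
Let C' i := enlarged_hull (C i) (delta_radius E V0 alphabar theta Gamma i).

Hypothesis V0_ge0 : 0 <= V0.
Hypothesis df : forall i z, differentiable (f i) z.
Hypothesis dgf : forall i z, differentiable (grad (f i)) z.
Hypothesis dgg : forall e, e \in E -> forall z, differentiable (grad (g e)) z.
Hypothesis hTheta : forall i,
  hess_bounds (f i) (conv_hull (C i)) (Theta i) (theta i).
Hypothesis hL : forall i, lipschitz_const (hess (f i)) (conv_hull (C i)) (L i).
Hypothesis hGamma : forall i j, [set i; j]%SET \in E ->
  hess_bounds (g [set i; j]%SET) (conv_hull (C i `|` C j))
    (Gamma [set i; j]%SET) (gamma [set i; j]%SET).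
Hypothesis hTheta' : forall i, hess_bounds (f i) (C' i) (Theta' i) (theta' i).
Hypothesis hL' : forall i, lipschitz_const (hess (f i)) (C' i) (L' i).
Hypothesis Theta'_le : forall i, theta' i <= Theta' i.
Hypothesis halpha : forall e, e \in E -> 0 < alpha e <= alphabar.
Hypothesis hstep : forall i j, [set i; j]%SET \in E ->
  alpha [set i; j]%SET * etatilde E V0 theta Theta' theta' L' i <=
    (Gamma [set i; j]%SET)^-1.

Let theta_gt0 i : 0 < theta i. Proof. by case: (hTheta i). Qed.

Let C_xs i : C i xs. Proof. by rewrite /C/= bregmanxx. Qed.

(** Strong convexity on the hull of [C i], which contains [xs], bounds the squared distance by the
    divergence. *)
Lemma sublevel_dist i x : C i x -> enorm (x - xs) <= Num.sqrt (2 * V0 / theta i).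
Proof.
move=> Cx; rewrite enormB -[leLHS]ger0_norm ?enorm_ge0// -sqrtr_sqr ler_wsqrtr//.
have := bregman_ge (@convex_conv_hull _ _ _) (df i) (dgf i) (hTheta i)
  (conv_hull_sub Cx) (conv_hull_sub (C_xs i)).
move=> /le_trans /(_ Cx); rewrite ler_pdivlMr//; lra.
Qed.

Context (x : 'I_N -> 'rV[R]_n).
Hypothesis Cx : forall i, C i (x i).
Hypothesis Vx : lyapunov f xs x <= V0.

Let w i j : 'rV[R]_n :=
  grad (g [set i; j]%SET) (x j) - grad (g [set i; j]%SET) (x i).
Let u i : 'rV[R]_n := \sum_(j in nbr E i) alpha [set i; j]%SET *: w i j.
Let d i : 'rV[R]_n := u i *m invmx (hess (f i) (x i)).
Let y := dean_map E f g alpha x.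

(* The sum over ordered pairs counts each link twice, hence the factor 1/2. *)
Definition energy_drop : R :=
  \sum_(i < N) \sum_(j in nbr E i) alpha [set i; j]%SET * enorm (w i j) ^+ 2 *
   ((Gamma [set i; j]%SET)^-1 -
    alpha [set i; j]%SET * etatilde E V0 theta Theta' theta' L' i) / 2.

Let wC i j : w j i = - w i j.
Proof. by rewrite /w (finset.setUC [set j]) opprB. Qed.

Let hull_l i j : conv_hull (C i `|` C j) (x i).
Proof. by apply: conv_hull_sub; left. Qed.

Let hull_r i j : conv_hull (C i `|` C j) (x j).
Proof. by apply: conv_hull_sub; right. Qed.

Let Gamma_gt0 i j : j \in nbr E i -> 0 < Gamma [set i; j]%SET.
Proof. by rewrite inE => /hGamma[]. Qed.

(** The first-order change of V. Since [w j i = - w i j], the two orderings of a link combine into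
    [- alpha w (x j - x i)], and cocoercivity of the gradient of g bounds this by
    [- alpha |w|^2 / Gamma]. *)
Lemma dotv_flux_le : \sum_(i < N) dotv (u i) (x i - xs) <=
  - \sum_(i < N) \sum_(j in nbr E i)
      alpha [set i; j]%SET * enorm (w i j) ^+ 2 * (Gamma [set i; j]%SET)^-1 / 2.
Proof.
pose F i j := alpha [set i; j]%SET * dotv (w i j) (x i - xs).
have -> : \sum_(i < N) dotv (u i) (x i - xs) =
    \sum_(i < N) \sum_(j in nbr E i) F i j.
  apply: eq_bigr => i _; rewrite dotv_suml.
  by apply: eq_bigr => j _; rewrite dotvZl.
have -> : \sum_(i < N) \sum_(j in nbr E i) F i j =
    \sum_(i < N) \sum_(j in nbr E i) (F i j + F j i) / 2.
  have h := exchange_nbr E F.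
  under [RHS]eq_bigr do rewrite -mulr_suml big_split/=.
  by rewrite -mulr_suml big_split/= -h; field.
rewrite -sumrN ler_sum// => i _; rewrite -sumrN ler_sum// => j ij.
have ijE : [set i; j]%SET \in E by move: ij; rewrite inE.
have /andP[a0 _] := halpha ijE.
have G0 := Gamma_gt0 ij.
have := grad_cocoercive (@convex_conv_hull _ _ _) (dgg ijE) (hGamma ijE)
  (@hull_l i j) (@hull_r i j).
rewrite -/(w i j) -ler_pdivrMl// => h.
rewrite /F (wC i j) (finset.setUC [set j]%SET).
have -> : alpha [set i; j]%SET * dotv (w i j) (x i - xs) +
    alpha [set i; j]%SET * dotv (- w i j) (x j - xs) =
    - (alpha [set i; j]%SET * dotv (w i j) (x j - x i)).
  by rewrite !dotv_expand; ring.
have := ler_wpM2l (ltW a0) h.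
set a := alpha _; set G := _^-1; set W := enorm _ ^+ 2; set D := dotv _ _.
lra.
Qed.

(** The inverse Hessian contributes [1 / theta i ^+ 2], and the square of a sum over the neighbours
    contributes their number. *)
Lemma sqr_enorm_move i : enorm (d i) ^+ 2 <= #|nbr E i|%:R / theta i ^+ 2 *
  \sum_(j in nbr E i) alpha [set i; j]%SET ^+ 2 * enorm (w i j) ^+ 2.
Proof.
have [_ _ hb] := hTheta i.
have [_ hi] := hb _ (conv_hull_sub (Cx i)).
have [_ hd] := enorm_invmx_le (u i) (theta_gt0 i) hi.
have : enorm (d i) ^+ 2 <= (enorm (u i) / theta i) ^+ 2.
  by rewrite ler_pXn2r// nnegrE ?divr_ge0 ?enorm_ge0// ltW.
move=> /le_trans; apply; rewrite expr_div_n [leRHS]mulrAC.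
rewrite ler_wpM2r ?invr_ge0 ?sqr_ge0//.
apply: (le_trans (sqr_enorm_sum _ _)); rewrite ler_wpM2l// ler_sum// => j ij.
by rewrite enormZ exprMn real_normK// num_real.
Qed.

(** Keeps the next state within [C' i] before it is known to be back in [C i]: both ends of a link
    are within their sublevel radii of [xs], and the gradient of g is Gamma-Lipschitz between
    them. *)
Lemma enorm_move i : enorm (d i) <= delta_radius E V0 alphabar theta Gamma i.
Proof.
have [_ _ hb] := hTheta i.
have [_ hi] := hb _ (conv_hull_sub (Cx i)).
have [_ hd] := enorm_invmx_le (u i) (theta_gt0 i) hi.
apply: (le_trans hd); rewrite /delta_radius mulrAC.
rewrite ler_wpM2r ?invr_ge0 ?(ltW (theta_gt0 i))//.
rewrite mulr_sumr; apply: (le_trans (enorm_sum _ _ _)).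
rewrite ler_sum// => j ij.
have ijE : [set i; j]%SET \in E by move: ij; rewrite inE.
have /andP[a0 a1] := halpha ijE.
rewrite enormZ (ger0_norm (ltW a0)) ler_pM ?enorm_ge0// ?(ltW a0)//.
apply: (le_trans (grad_lipschitz (@convex_conv_hull _ _ _) (dgg ijE) (hGamma ijE)
  (@hull_l i j) (@hull_r i j))).
rewrite ler_wpM2l ?(ltW (Gamma_gt0 ij))//.
rewrite (_ : x j - x i = (x j - xs) - (x i - xs)); last first.
  by rewrite opprB addrA subrK.
by rewrite (le_trans (enormD _ _))// enormN addrC lerD// sublevel_dist.
Qed.

Let C'_x i : C' i (x i).
Proof.
apply: conv_hull_sub; exists (x i); first exact: Cx.
by rewrite subrr enorm0 (le_trans (enorm_ge0 (d i)))// enorm_move.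
Qed.

Let C'_xs i : C' i xs.
Proof.
apply: conv_hull_sub; exists xs; first exact: C_xs.
by rewrite subrr enorm0 (le_trans (enorm_ge0 (d i)))// enorm_move.
Qed.

Let C'_y i : C' i (y i).
Proof.
apply: conv_hull_sub; exists (x i); first exact: Cx.
by rewrite /y /dean_map addrC addKr enorm_move.
Qed.

(** [bregman_step] on [C' i], where d times the Hessian is u; its quadratic constant times
    [#|nbr E i| / theta i ^+ 2] is half of [etatilde]. *)
Lemma bregman_node i : bregman (f i) xs (y i) <= bregman (f i) xs (x i) +
  dotv (u i) (x i - xs) + \sum_(j in nbr E i) alpha [set i; j]%SET ^+ 2 *
    enorm (w i j) ^+ 2 * etatilde E V0 theta Theta' theta' L' i / 2.
Proof.
have [_ _ hb] := hTheta i.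
have [_ hi] := hb _ (conv_hull_sub (Cx i)).
have [dH _] := enorm_invmx_le (u i) (theta_gt0 i) hi.
have := bregman_step (df i) (dgf i) (@convex_conv_hull _ _ _) (hTheta' i)
  (Theta'_le i) (hL' i) (@C'_x i) (@C'_y i) (sublevel_dist (Cx i)).
rewrite dH => /le_trans; apply; rewrite lerD2l.
have c0 : 0 <= Theta' i - theta' i / 2 +
    L' i / 2 * Num.sqrt (2 * V0 / theta i).
  rewrite addr_ge0// ?mulr_ge0 ?divr_ge0 ?sqrtr_ge0//; last by case: (hL' i).
  have [_ t0 _] := hTheta' i; have := Theta'_le i; lra.
apply: (le_trans (ler_wpM2l c0 (sqr_enorm_move i))).
rewrite mulrA mulr_sumr le_eqVlt; apply/orP; left; apply/eqP.
apply: eq_bigr => j _; rewrite /etatilde; field.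
by rewrite gt_eqF.
Qed.

Lemma dean_energy : lyapunov f xs y <= lyapunov f xs x - energy_drop.
Proof.
rewrite /lyapunov (le_trans (ler_sum _ (fun i _ => bregman_node i)))//.
rewrite !big_split/= -addrA lerD2l.
apply: (le_trans (lerD dotv_flux_le (lexx _))).
rewrite -sumrN -big_split/= /energy_drop -sumrN ler_sum// => i _.
rewrite -sumrN -big_split/= -sumrN ler_sum// => j _.
rewrite le_eqVlt; apply/orP; left; apply/eqP; ring.
Qed.

Lemma energy_drop_term_ge0 i j : j \in nbr E i ->
  0 <= alpha [set i; j]%SET * enorm (w i j) ^+ 2 *
   ((Gamma [set i; j]%SET)^-1 -
    alpha [set i; j]%SET * etatilde E V0 theta Theta' theta' L' i) / 2.
Proof.
rewrite inE => ijE; have /andP[a0 _] := halpha ijE.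
by rewrite divr_ge0// mulr_ge0 ?subr_ge0 ?hstep// mulr_ge0 ?sqr_ge0// ltW.
Qed.

Lemma energy_drop_ge0 : 0 <= energy_drop.
Proof.
by apply: sumr_ge0 => i _; apply: sumr_ge0 => j; exact: energy_drop_term_ge0.
Qed.

Lemma dean_lyapunov_le : lyapunov f xs y <= V0.
Proof.
apply: (le_trans dean_energy); rewrite (le_trans _ Vx)// gerBl.
exact: energy_drop_ge0.
Qed.

(** Every divergence is nonnegative by convexity on the larger sets [C'], so each one is bounded by
    their sum V, which has not increased. *)
Lemma dean_invariant i : C i (y i).
Proof.
apply: (le_trans _ dean_lyapunov_le); rewrite /lyapunov (bigD1 i)//= lerDl.
apply: sumr_ge0 => j _.
have [_ t0 _] := hTheta' j.
apply: le_trans (bregman_ge (@convex_conv_hull _ _ _) (df j) (dgf j)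
  (hTheta' j) (@C'_y j) (@C'_xs j)).
by rewrite mulr_ge0 ?sqr_ge0// ltW// divr_gt0.
Qed.

(** Keep one term of a nonnegative sum and use [|w| >= gamma |x j - x i|]. A vanishing energy drop
    thus forces agreement across the link. *)
Lemma edge_le_energy_drop i j : j \in nbr E i ->
  alpha [set i; j]%SET * gamma [set i; j]%SET ^+ 2 *
   ((Gamma [set i; j]%SET)^-1 -
    alpha [set i; j]%SET * etatilde E V0 theta Theta' theta' L' i) / 2 *
   enorm (x j - x i) ^+ 2 <= energy_drop.
Proof.
move=> ij; have ijE : [set i; j]%SET \in E by move: ij; rewrite inE.
have /andP[a0 _] := halpha ijE.
have [_ g0 _] := hGamma ijE.
rewrite /energy_drop (bigD1 i)//= (bigD1 j)//= -addrA ler_wpDr//.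
  rewrite addr_ge0//.
    by apply: sumr_ge0 => k /andP[+ _]; exact: energy_drop_term_ge0.
  by apply: sumr_ge0 => k _; apply: sumr_ge0 => l; exact: energy_drop_term_ge0.
have := grad_expansive (@convex_conv_hull _ _ _) (dgg ijE) (hGamma ijE)
  (@hull_l i j) (@hull_r i j).
rewrite -/(w i j) => h1.
have h : gamma [set i; j]%SET ^+ 2 * enorm (x j - x i) ^+ 2 <=
    enorm (w i j) ^+ 2.
  by rewrite -exprMn ler_pXn2r// nnegrE ?mulr_ge0 ?enorm_ge0// ltW.
have c0 : 0 <= (Gamma [set i; j]%SET)^-1 -
    alpha [set i; j]%SET * etatilde E V0 theta Theta' theta' L' i.
  by rewrite subr_ge0 hstep.
move: c0 h a0; set c := (_ - _) => c0 h a0.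
have := ler_wpM2l (mulr_ge0 (ltW a0) c0) h; lra.
Qed.

(** To first order the sum of gradients is preserved; the remainders are quadratic in d, hence in w,
    and the assumption on K compares them term by term with [energy_drop]. *)
Lemma grad_sum_drift (K eps : R) : 0 <= K ->
  (forall i j, j \in nbr E i ->
     K * alpha [set i; j]%SET * (#|nbr E i|%:R * L i / theta i ^+ 2) <=
     eps * ((Gamma [set i; j]%SET)^-1 -
       alpha [set i; j]%SET * etatilde E V0 theta Theta' theta' L' i)) ->
  K * enorm (\sum_(i < N) grad (f i) (y i) - \sum_(i < N) grad (f i) (x i)) <=
  eps * energy_drop.
Proof.
move=> K0 hK.
(* The product of [d i] with the Hessian is [u i], and the sum of the [u i] equals its own opposite
   because the fluxes are antisymmetric. *)
have dS : \sum_(i < N) d i *m hess (f i) (x i) = 0.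
  have -> : \sum_(i < N) d i *m hess (f i) (x i) = \sum_(i < N) u i.
    apply: eq_bigr => i _; have [_ _ hb] := hTheta i.
    have [_ hi] := hb _ (conv_hull_sub (Cx i)).
    by have [] := enorm_invmx_le (u i) (theta_gt0 i) hi.
  have uN : \sum_(i < N) u i = - \sum_(i < N) u i.
    rewrite [LHS]exchange_nbr -sumrN; apply: eq_bigr => i _.
    rewrite -sumrN; apply: eq_bigr => j _.
    by rewrite (wC i j) (finset.setUC [set j]%SET) scalerN.
  have : \sum_(i < N) u i + \sum_(i < N) u i = 0 by rewrite [X in X + _]uN addNr.
  by move/eqP; rewrite -mulr2n -scaler_nat scaler_eq0 pnatr_eq0/= => /eqP.
have -> : \sum_(i < N) grad (f i) (y i) - \sum_(i < N) grad (f i) (x i) =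
    \sum_(i < N) (grad (f i) (y i) - grad (f i) (x i) -
      d i *m hess (f i) (x i)).
  by rewrite !sumrB dS subr0.
rewrite (le_trans (ler_wpM2l K0 (enorm_sum _ _ _)))//.
rewrite mulr_sumr /energy_drop mulr_sumr.
rewrite ler_sum// => i _.
(* Both ends now lie in [C i], so the constant [L i] on its hull applies. *)
have := grad_remainder (@convex_conv_hull _ _ _) (dgf i) (hL i)
  (conv_hull_sub (Cx i)) (conv_hull_sub (dean_invariant i)).
move=> /(ler_wpM2l K0) /le_trans; apply.
have L0 : 0 <= L i by case: (hL i).
apply: (@le_trans _ _ (K * (L i / 2 * (#|nbr E i|%:R / theta i ^+ 2 *
  \sum_(j in nbr E i) alpha [set i; j]%SET ^+ 2 * enorm (w i j) ^+ 2)))).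
  by rewrite ler_wpM2l// ler_wpM2l ?divr_ge0// sqr_enorm_move.
rewrite !mulr_sumr ler_sum// => j ij.
have ijE : [set i; j]%SET \in E by move: ij; rewrite inE.
have /andP[a0 _] := halpha ijE.
have := ler_wpM2l (mulr_ge0 (ltW a0) (sqr_ge0 (enorm (w i j)))) (hK i j ij).
lra.
Qed.

End dean_step.

(** * Limits of real sequences *)

Section real_sequences.
Context (R : realType).
Implicit Types (V q l e t v : R^nat) (a b c eps : R).

Lemma cvg0_sqr_le t v c : 0 < c -> (forall k, 0 <= t k) ->
  (forall k, c * t k ^+ 2 <= v k) -> v @ \oo --> (0 : R) -> t @ \oo --> (0 : R).
Proof.
move=> c0 t0 tv v0; apply/cvgrPdist_lt => r r0.
have cr0 : 0 < c * r ^+ 2 by rewrite mulr_gt0 ?exprn_gt0.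
move/cvgrPdist_lt : v0 => /(_ _ cr0); apply: filterS => k.
rewrite !sub0r !normrN (ger0_norm (t0 k)) => /(le_lt_trans (ler_norm _)) vk.
have := le_lt_trans (tv k) vk; rewrite ltr_pM2l//.
by rewrite ltr_pXn2r// nnegrE// ltW.
Qed.

Lemma cvg0_sum (N : nat) (t : 'I_N -> R^nat) :
  (forall i, t i @ \oo --> (0 : R)) ->
  (fun k => \sum_(i < N) t i k) @ \oo --> (0 : R).
Proof.
move=> t0; rewrite (_ : (fun k => _) = \sum_(i < N) t i); last first.
  by apply/funext => k; rewrite fct_sumE.
elim/big_ind : _ => // [|u v u0 v0]; first exact: cvg_cst.
by rewrite -(addr0 (0 : R)); apply: cvgD.
Qed.

(** V is nonincreasing and bounded below, hence Cauchy, and q inherits this from the bound on its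
    increments. *)
Lemma cvg_controlled V q e a : (forall m k, (m <= k)%N -> V k <= V m) ->
  (forall k, 0 <= V k) -> 0 <= a -> e @ \oo --> (0 : R) ->
  (forall m k, (m <= k)%N -> `|q k - q m| <= a * (V m - V k) + e m + e k) ->
  cvgn q.
Proof.
move=> Vmon V0 a0 e0 hq.
have [Vl cV] : exists Vl : R, V @ \oo --> Vl.
  exists (inf (range V)); apply: nonincreasing_cvgn => //.
  by exists 0 => _ [k _ <-].
apply: (@cauchy_cvg R (q @ \oo)); apply: cauchy_exP => r r0.
(* a + 1 replaces a in the denominator, as a may be 0. *)
have a1 : 0 < r / (4 * (a + 1)) by rewrite divr_gt0// mulr_gt0// ltr_wpDl.
have r4 : 0 < r / 4 by rewrite divr_gt0.
have /cvgrPdist_lt/(_ _ a1)[m1 _ h1] := cV.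
have /cvgrPdist_lt/(_ _ r4)[m2 _ h2] := e0.
pose m := maxn m1 m2; exists (q m); exists m => // k /= mk.
have Vle := Vmon _ _ mk.
have hm1 : `|Vl - V m| < r / (4 * (a + 1)) by apply: h1; rewrite /= leq_maxl.
have hk1 : `|Vl - V k| < r / (4 * (a + 1)).
  by apply: h1; rewrite /= (leq_trans _ mk)// leq_maxl.
have hm2 : `|0 - e m| < r / 4 by apply: h2; rewrite /= leq_maxr.
have hk2 : `|0 - e k| < r / 4.
  by apply: h2; rewrite /= (leq_trans _ mk)// leq_maxr.
rewrite /ball/= distrC (le_lt_trans (hq _ _ mk))//.
have hV : a * (V m - V k) <= r / 2.
  have : V m - V k <= r / (2 * (a + 1)).
    rewrite (_ : r / (2 * (a + 1)) =
      r / (4 * (a + 1)) + r / (4 * (a + 1))); last first.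
      by field; rewrite gt_eqF// ltr_wpDl.
    by move: hm1 hk1; rewrite !ltr_norml => /andP[? ?] /andP[? ?]; lra.
  move=> /(ler_wpM2l a0) /le_trans; apply.
  rewrite mulrA ler_pdivrMr ?mulr_gt0 ?ltr_wpDl//; nra.
move: hm2 hk2; rewrite !ltr_norml => /andP[? ?] /andP[? ?]; lra.
Qed.

(** To be used with V the Lyapunov values, q the distance of a reference node to x*, l the distance
    of the stacked state, c the square root of N, and e, e1 consensus errors. *)
Lemma cvg_lt_controlled V q l e e1 a b c eps :
  0 < eps -> 0 <= a -> 0 <= b ->
  (forall m k, (m <= k)%N -> V k <= V m) -> (forall k, 0 <= V k) -> 0 < V 0%N ->
  e @ \oo --> (0 : R) -> e1 @ \oo --> (0 : R) ->
  (forall m k, (m <= k)%N -> `|q k - q m| <= a * (V m - V k) + e m + e k) ->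
  (forall k, `|l k - c * q k| <= e1 k) ->
  (forall k, c * q k <= eps * (V 0%N - V k) / V 0%N + c * e k) ->
  (forall k, 0 <= l k) -> (forall k, l k ^+ 2 <= b * V k) ->
  exists2 L : R, l @ \oo --> L & L < eps.
Proof.
move=> eps0 a0 b0 Vmon V0 V00 ce ce1 hq hl hc l0 lV.
have [Vl cV] : exists Vl : R, V @ \oo --> Vl.
  exists (inf (range V)); apply: nonincreasing_cvgn => //.
  by exists 0 => _ [k _ <-].
have [ql cq] : exists ql : R, q @ \oo --> ql.
  by exists (lim (q @ \oo)); exact: cvg_controlled Vmon V0 a0 ce hq.
have ccq : (fun k => c * q k) @ \oo --> c * ql by apply: cvgM cq; exact: cvg_cst.
have cl : l @ \oo --> c * ql.
  have -> : l = (fun k => c * q k + (l k - c * q k)).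
    by apply/funext => k; rewrite addrC subrK.
  rewrite -[c * ql]addr0; apply: cvgD => //.
  apply: norm_cvg0; apply: squeeze_cvgr (cvg_cst 0) ce1.
  by apply: nearW => k; rewrite normr_ge0 hl.
have Vl0 : 0 <= Vl by apply: ler_cvg_to (cvg_cst 0) cV _; exact: nearW.
exists (c * ql) => //.
have le_l : c * ql <= eps * (V 0%N - Vl) / V 0%N + c * 0.
  apply: ler_cvg_to ccq _ (nearW _ hc).
  apply: cvgD; last by apply: cvgM ce; exact: cvg_cst.
  apply: cvgM; last exact: cvg_cst.
  apply: cvgM; first exact: cvg_cst.
  by apply: cvgB cV; exact: cvg_cst.
have l_ge0 : 0 <= c * ql by apply: ler_cvg_to (cvg_cst 0) cl _; exact: nearW.
have le_sq : (c * ql) ^+ 2 <= b * Vl.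
  have cl2 : (fun k => l k ^+ 2) @ \oo --> (c * ql) ^+ 2 by exact: (cvgM cl cl).
  have cbV : (fun k => b * V k) @ \oo --> b * Vl by apply: cvgM cV; exact: cvg_cst.
  exact: ler_cvg_to cl2 cbV (nearW _ lV).
(* Strictness: a positive limit of V makes the factor [(V 0 - Vl) / V 0] less than 1, while a zero
   limit forces l to tend to 0. *)
have [Vl_eq0|Vl_neq0] := eqVneq Vl 0.
  move: le_sq; rewrite Vl_eq0 mulr0 => le_sq.
  have /eqP : (c * ql) ^+ 2 = 0 by apply/eqP; rewrite eq_le le_sq sqr_ge0.
  by rewrite sqrf_eq0 => /eqP ->.
apply: (le_lt_trans le_l); rewrite mulr0 addr0 ltr_pdivrMr// ltr_pM2l//.
by rewrite gtrBl lt_def Vl_neq0.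
Qed.

End real_sequences.

(** * Convergence *)

(** Induction along a path from i to j with the triangle inequality. *)
Lemma connected_consensus (R : realType) (N n : nat) (E : {set {set 'I_N}})
    (x : nat -> 'I_N -> 'rV[R]_n) : connected_graph E ->
  (forall i j, [set i; j]%SET \in E ->
     (fun k => enorm (x k j - x k i)) @ \oo --> (0 : R)) ->
  forall i j, (fun k => enorm (x k j - x k i)) @ \oo --> (0 : R).
Proof.
move=> hconn hedge i j; have /connectP[p] := hconn i j.
elim: p i => [|l p IH] i /=.
  move=> _ ->; under eq_fun do rewrite subrr enorm0.
  exact: cvg_cst.
move=> /andP[il lp] jp; have {}il : [set i; l]%SET \in E by move: il; rewrite inE.
have h : (fun k => enorm (x k j - x k l) + enorm (x k l - x k i)) @ \oo --> (0 : R).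
  by rewrite -(addr0 0); apply: cvgD; [exact: IH|exact: hedge].
apply: squeeze_cvgr (cvg_cst 0) h; apply: nearW => k.
rewrite enorm_ge0/= (_ : x k j - x k i = (x k j - x k l) + (x k l - x k i)).
  exact: enormD.
by rewrite addrA subrK.
Qed.

(** Strong monotonicity adds up over the nodes, all evaluated at the same two points; Cauchy-Schwarz
    then gives the bound on norms. *)
Lemma sum_grad_expansive (R : realType) (N n : nat) (f : 'I_N -> 'rV[R]_n -> R)
    (C : set 'rV[R]_n) (Theta theta : 'I_N -> R) x y :
  convex_set C -> (forall i z, differentiable (grad (f i)) z) ->
  (forall i, hess_bounds (f i) C (Theta i) (theta i)) -> C x -> C y ->
  (\sum_(i < N) theta i) * enorm (y - x) <=
  enorm (\sum_(i < N) grad (f i) y - \sum_(i < N) grad (f i) x).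
Proof.
move=> cC dg hb Cx Cy; rewrite -sumrB; set w := \sum_i _.
have [->|w0] := eqVneq (enorm (y - x)) 0; first by rewrite mulr0 enorm_ge0.
have ew : 0 < enorm (y - x) by rewrite lt_def w0 enorm_ge0.
rewrite -(ler_pM2r ew) (le_trans _ (cauchy_schwarz _ _))// /w dotv_suml.
rewrite -mulrA -expr2 sqr_enorm mulr_suml ler_sum// => i _.
exact: grad_strongly_monotone cC (dg i) (hb i) Cx Cy.
Qed.

Theorem theorem2 (R : realType) (N n : nat) (hN : (2 <= N)%N) (hn : (1 <= n)%N)
  (E : {set {set 'I_N}}) (hE : is_graph E) (hconn : connected_graph E)
  (f : 'I_N -> 'rV[R]_n -> R) (g : {set 'I_N} -> 'rV[R]_n -> R)
  (A1 : forall i,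
     [/\ twice_cont_diff (f i), locally_strongly_convex (f i),
         exists x, is_minimizer (f i) x & locally_lipschitz (hess (f i))])
  (A2 : forall e, e \in E ->
     twice_cont_diff (g e) /\ locally_strongly_convex (g e))
  (xm : 'I_N -> 'rV[R]_n) (hxm : forall i, is_minimizer (f i) (xm i))
  (xs : 'rV[R]_n) (hxs : is_minimizer (fun x => \sum_(i < N) f i x) xs)
  (A3 : forall i, coercive (bregman (f i) xs))
  (Theta theta L : 'I_N -> R)
  (hTheta : forall i,
     hess_bounds (f i) (conv_hull (sublevel f xs xm i)) (Theta i) (theta i))
  (hL : forall i,
     lipschitz_const (hess (f i)) (conv_hull (sublevel f xs xm i)) (L i))
  (Thetabar thetabar : 'I_N -> R)
  (hThetabar : forall i,
     hess_bounds (f i) (conv_hull (\bigcup_j sublevel f xs xm j))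
       (Thetabar i) (thetabar i))
  (Gamma gamma : {set 'I_N} -> R)
  (hGamma : forall i j, [set i; j]%SET \in E ->
     hess_bounds (g [set i; j]%SET)
       (conv_hull (sublevel f xs xm i `|` sublevel f xs xm j))
       (Gamma [set i; j]%SET) (gamma [set i; j]%SET))
  (alphabar : R) (halphabar : 0 < alphabar)
  (Theta' theta' L' : 'I_N -> R)
  (hTheta' : forall i,
     hess_bounds (f i)
       (enlarged_hull (sublevel f xs xm i)
          (delta_radius E (lyapunov f xs xm) alphabar theta Gamma i))
       (Theta' i) (theta' i))
  (hL' : forall i,
     lipschitz_const (hess (f i))
       (enlarged_hull (sublevel f xs xm i)
          (delta_radius E (lyapunov f xs xm) alphabar theta Gamma i))
       (L' i))
  (hcmp : forall i, [/\ Theta i <= Theta' i, theta' i <= theta i & L i <= L' i])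
  (alpha : {set 'I_N} -> R)
  (halpha : forall e, e \in E -> 0 < alpha e <= alphabar)
  (x : nat -> 'I_N -> 'rV[R]_n) (hx : dean_sequence E f g alpha xm x) :
  let V0 := lyapunov f xs xm in
  let et := eta E V0 theta thetabar L in
  let ett := etatilde E V0 theta Theta' theta' L' in
  (forall i, 0 <= et i /\ 0 < ett i) /\
  forall eps : R, 0 < eps ->
    (forall i j, [set i; j]%SET \in E ->
       alpha [set i; j]%SET < eps / Gamma [set i; j]%SET *
         Num.min (1 / (et i + ett i * eps)) (1 / (et j + ett j * eps))) ->
    exists2 l : R,
      (fun k => enorm (stack (x k) - stack (fun=> xs))) @ \oo --> l
      & l < eps.
Proof.
move=> V0 et ett.
have df i z : differentiable (f i) z by have [[]] := A1 i.
have dgf i z : differentiable (grad (f i)) z by have [[]] := A1 i.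
have dgg e (eE : e \in E) z : differentiable (grad (g e)) z.
  by have [[]] := A2 e eE.
have gm i : grad (f i) (xm i) = 0 by exact: grad_minimizer (df i) (hxm i).
have V0_ge0 : 0 <= V0.
  apply: sumr_ge0 => i _; rewrite /bregman gm dotv0l subr0 subr_ge0.
  exact: hxm.
have C_xs i : sublevel f xs xm i xs by rewrite /sublevel/= bregmanxx.
have theta_gt0 i : 0 < theta i by have [] := hTheta i.
have thetabar_gt0 i : 0 < thetabar i by have [] := hThetabar i.
have theta'_gt0 i : 0 < theta' i by have [] := hTheta' i.
have Theta'_le i : theta' i <= Theta' i.
  have [h1 h2 _] := hcmp i.
  have h3 := hess_bounds_le hn (hTheta i) (conv_hull_sub (C_xs i)).
  by rewrite (le_trans h2)// (le_trans h3).
have N_gt0 : (0 < N)%N by exact: leq_trans hN.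
pose i0 : 'I_N := Ordinal N_gt0.
pose Tb := \sum_(i < N) thetabar i.
have Tb_gt0 : 0 < Tb.
  rewrite /Tb (bigD1 i0)//= ltr_wpDr// sumr_ge0// => j _; exact: ltW.
(* Since there are at least two nodes, a path to a different node starts with a neighbour of i. This
   makes [ett i] positive. *)
have nbr_gt0 i : (0 < #|nbr E i|)%N.
  pose i1 : 'I_N := Ordinal hN.
  have [j ij] : exists j : 'I_N, i != j.
    have [->|ne] := eqVneq i i0; last by exists i0.
    by exists i1.
  have /connectP[[|l p] /=] := hconn i j.
    by move=> _ jE; rewrite jE eqxx in ij.
  by move=> /andP[il _] _; apply/card_gt0P; exists l.
have et_ge0 i : 0 <= et i.
  have [L0 _] := hL i.
  rewrite divr_ge0 ?mulr_ge0 ?sqrtr_ge0 ?sqr_ge0//; exact: ltW.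
have ett_gt0 i : 0 < ett i.
  have [L0 _] := hL' i.
  apply: mulr_gt0.
    by rewrite divr_gt0 ?exprn_gt0// mulr_gt0// ltr0n.
  rewrite ltr_wpDr// ?mulr_ge0 ?divr_ge0 ?sqrtr_ge0//.
  have := Theta'_le i; have := theta'_gt0 i; lra.
split=> // eps eps_gt0 halp.
have Gamma_gt0 i j : [set i; j]%SET \in E -> 0 < Gamma [set i; j]%SET.
  by move=> /hGamma[].
(* The step-size condition at node i, cleared of denominators; the condition at j is the same
   statement with i and j exchanged. *)
have step_slack i j : [set i; j]%SET \in E ->
    alpha [set i; j]%SET * et i <
    eps * ((Gamma [set i; j]%SET)^-1 - alpha [set i; j]%SET * ett i).
  move=> ijE; have a_lt := halp i j ijE.
  have D_gt0 : 0 < et i + ett i * eps by rewrite ltr_wpDl// mulr_gt0.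
  have : alpha [set i; j]%SET < eps / Gamma [set i; j]%SET / (et i + ett i * eps).
    rewrite (lt_le_trans a_lt)// ler_wpM2l//.
      by rewrite divr_ge0 ?(ltW (Gamma_gt0 _ _ ijE)) ?(ltW eps_gt0).
    by rewrite ge_min div1r lexx.
  rewrite ltr_pdivlMr//; lra.
have step_small i j : [set i; j]%SET \in E ->
    alpha [set i; j]%SET * ett i < (Gamma [set i; j]%SET)^-1.
  move=> ijE; have /andP[a0 _] := halpha _ ijE.
  have := le_lt_trans (mulr_ge0 (ltW a0) (et_ge0 i)) (step_slack i j ijE).
  by rewrite pmulr_rgt0// subr_gt0.
have step_le i j : [set i; j]%SET \in E ->
    alpha [set i; j]%SET * ett i <= (Gamma [set i; j]%SET)^-1.
  by move=> ijE; rewrite ltW// step_small.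
have [x0E xSE] := hx.
have x0 : x 0%N = xm by apply/funext.
have xS k : x k.+1 = dean_map E f g alpha (x k) by apply/funext => i; exact: xSE.
pose V k := lyapunov f xs (x k).
(* Both invariants are proved by one induction, since each one-step estimate needs the state in the
   sublevel sets and V at most V0. *)
have [Ck Vk] : (forall k i, sublevel f xs xm i (x k i)) /\ forall k, V k <= V0.
  suff inv k : (forall i, sublevel f xs xm i (x k i)) /\ V k <= V0.
    by split => k; have [] := inv k.
  rewrite /V; elim: k => [|k [Ck Vk]].
    rewrite x0; split=> // i; rewrite /sublevel/= /lyapunov (bigD1 i)//= lerDl.
    apply: sumr_ge0 => j _; rewrite /bregman gm dotv0l subr0 subr_ge0.
    exact: hxm.
  rewrite xS; split=> [i|].
    exact: (dean_invariant V0_ge0 df dgf dgg hTheta hGamma hTheta' hL' Theta'_le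
      halpha step_le Ck Vk).
  exact: (dean_lyapunov_le V0_ge0 df dgf dgg hTheta hGamma hTheta' hL' Theta'_le
    halpha step_le Ck Vk).
pose D k := energy_drop E g V0 theta Theta' theta' L' Gamma alpha (x k).
have D_ge0 k : 0 <= D k by exact: (energy_drop_ge0 g halpha step_le).
have VS k : D k <= V k - V k.+1.
  have := dean_energy V0_ge0 df dgf dgg hTheta hGamma hTheta' hL' Theta'_le
    halpha (Ck k).
  rewrite -xS -/(V k.+1) -/(V k) -/(D k); lra.
have breg_ge k i : theta i / 2 * enorm (xs - x k i) ^+ 2 <= bregman (f i) xs (x k i).
  exact: bregman_ge (@convex_conv_hull _ _ _) (df i) (dgf i) (hTheta i)
    (conv_hull_sub (Ck k i)) (conv_hull_sub (C_xs i)).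
have breg_ge0 k i : 0 <= bregman (f i) xs (x k i).
  by rewrite (le_trans _ (breg_ge k i))// mulr_ge0 ?sqr_ge0// divr_ge0// ltW.
have V_ge0 k : 0 <= V k by apply: sumr_ge0 => i _; exact: breg_ge0.
have Vmon m k : (m <= k)%N -> V k <= V m.
  elim: k => [|k IH]; first by rewrite leqn0 => /eqP ->.
  rewrite leq_eqVlt => /predU1P[->//|/IH Vkm].
  by have := VS k; have := D_ge0 k; lra.
have VSto0 : (fun k => V k - V k.+1) @ \oo --> (0 : R).
  have cV : cvgn V.
    by apply: nonincreasing_is_cvgn => //; exists 0 => _ [k _ <-].
  rewrite -(subrr (limn V)); apply: cvgB => //.
  by rewrite (cvg_shiftS V).
(* Consensus error, measured against the reference node [i0]. *)
pose s k := \sum_(i < N) enorm (x k i - x k i0).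
have sto0 : s @ \oo --> (0 : R).
  apply: cvg0_sum => i; apply: (connected_consensus hconn) => {}i j ijE.
  have /andP[a0 _] := halpha _ ijE.
  have [_ g0 _] := hGamma _ _ ijE.
  (* The constant of [edge_le_energy_drop], positive because the step-size condition is strict. *)
  apply: (cvg0_sqr_le (c := alpha [set i; j]%SET * gamma [set i; j]%SET ^+ 2 *
    ((Gamma [set i; j]%SET)^-1 - alpha [set i; j]%SET * ett i) / 2) _ _ _ VSto0).
  - by rewrite divr_gt0// mulr_gt0 ?subr_gt0 ?step_small// mulr_gt0// exprn_gt0.
  - by move=> k; exact: enorm_ge0.
  - move=> k; apply: (le_trans _ (VS k)).
    apply: (edge_le_energy_drop dgg hGamma halpha step_le (Ck k)).
    by rewrite inE.
have s_ge0 k : 0 <= s k by apply: sumr_ge0 => i _; exact: enorm_ge0.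
pose S k := \sum_(i < N) grad (f i) (x k i).
(* Chosen so that K times [#|nbr E i| * L i / theta i ^+ 2] is [et i]; the assumption of
   [grad_sum_drift] then becomes [step_slack]. *)
pose K := Num.sqrt N%:R * V0 / Tb.
have K_ge0 : 0 <= K by rewrite divr_ge0 ?mulr_ge0 ?sqrtr_ge0// ltW.
have SS k : K * enorm (S k.+1 - S k) <= eps * (V k - V k.+1).
  apply: (@le_trans _ _ (eps * D k)); last by rewrite ler_wpM2l// ltW.
  rewrite /S xS; apply: (grad_sum_drift V0_ge0 df dgf dgg hTheta hL hGamma
    hTheta' hL' Theta'_le halpha step_le (Ck k) (Vk k) K_ge0) => i j.
  rewrite inE => ijE; rewrite (le_trans _ (ltW (step_slack i j ijE)))//.
  rewrite /K /et /eta -/Tb le_eqVlt; apply/orP; left; apply/eqP; field.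
  by rewrite !gt_eqF.
have S0 : S 0%N = 0 by rewrite /S x0 big1.
pose l k := enorm (stack (x k) - stack (fun=> xs)).
have l_ge0 k : 0 <= l k by exact: enorm_ge0.
have [B B_ge0 lV] : exists2 B : R, 0 <= B & forall k, l k ^+ 2 <= B * V k.
  exists (\sum_(i < N) 2 / theta i).
    by apply: sumr_ge0 => i _; rewrite divr_ge0// ltW.
  move=> k; rewrite /l stackB sqr_enorm_stack mulr_suml ler_sum// => i _.
  apply: (@le_trans _ _ (2 / theta i * bregman (f i) xs (x k i))).
    rewrite enormB mulrAC ler_pdivlMr//; have := breg_ge k i; lra.
  rewrite ler_wpM2l ?divr_ge0 ?(ltW (theta_gt0 i))//.
  rewrite /V /lyapunov (bigD1 i)//= lerDl.
  by apply: sumr_ge0.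
(* If V0 vanishes, so does every [V k], and the iterates stay at x*. Otherwise V0 and K can be
   divided by. *)
have [V0_eq0|V0_neq0] := eqVneq V0 0.
  exists 0 => //; rewrite (_ : (fun k => _) = cst 0); first exact: cvg_cst.
  apply/funext => k; apply/eqP; rewrite -sqrf_eq0 eq_le sqr_ge0 andbT.
  apply: (le_trans (lV k)); have -> : V k = 0; last by rewrite mulr0.
  by apply/eqP; rewrite eq_le V_ge0 andbT -V0_eq0 Vk.
have V0_gt0 : 0 < V0 by rewrite lt_def V0_neq0.
have sqrtN_gt0 : 0 < Num.sqrt N%:R :> R by rewrite sqrtr_gt0 ltr0n.
have K_gt0 : 0 < K by rewrite divr_gt0 ?mulr_gt0.
(* A convex set containing all states of all nodes, on which every gradient may be evaluated at the
   state of [i0]. *)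
pose Hbar := conv_hull (\bigcup_j sublevel f xs xm j).
have Hx k i : Hbar (x k i) by apply: conv_hull_sub; exists i.
have Hxs : Hbar xs by apply: conv_hull_sub; exists i0.
pose F z := \sum_(i < N) grad (f i) z.
pose T := \sum_(i < N) Thetabar i.
have Thetabar_gt0 i : 0 < Thetabar i by have [] := hThetabar i.
have Fxs : F xs = 0.
  rewrite /F -grad_sum//.
  apply: grad_minimizer hxs => z.
  rewrite (_ : (fun y => _) = \sum_(i < N) f i); first exact: differentiable_sum.
  by apply/funext => y; rewrite fct_sumE.
have Fmono y z : Hbar y -> Hbar z -> Tb * enorm (z - y) <= enorm (F z - F y).
  by move=> Hy Hz; exact: (sum_grad_expansive (@convex_conv_hull _ _ _) dgf hThetabar).
(* Moving all nodes to the state of [i0] changes the sum of gradients by at most a multiple of the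
   consensus error. *)
have FS k : enorm (F (x k i0) - S k) <= T * s k.
  rewrite /F /S -sumrB (le_trans (enorm_sum _ _ _))//.
  rewrite /T mulr_suml ler_sum// => i _.
  apply: (le_trans (grad_lipschitz (@convex_conv_hull _ _ _) (dgf i) (hThetabar i)
    (Hx k i) (Hx k i0))).
  rewrite ler_wpM2l ?(ltW (Thetabar_gt0 i))// enormB /s (bigD1 i)//= lerDl.
  by apply: sumr_ge0 => j _; exact: enorm_ge0.
have VE : V 0%N = V0 by rewrite /V x0.
clearbody V S F.
(* [SS] telescopes. *)
have Sdrift m k : (m <= k)%N -> K * enorm (S k - S m) <= eps * (V m - V k).
  elim: k => [|k IH].
    by rewrite leqn0 => /eqP ->; rewrite !subrr enorm0 !mulr0.
  rewrite leq_eqVlt => /predU1P[->|/IH h].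
    by rewrite !subrr enorm0 !mulr0.
  have := ler_wpM2l K_ge0 (enormD (S k.+1 - S k) (S k - S m)).
  rewrite addrA subrK mulrDr; have := SS k; lra.
pose q k := enorm (x k i0 - xs).
pose e k := T / Tb * s k.
have cvg_scale c : (fun k => c * s k) @ \oo --> (0 : R).
  by rewrite -(mulr0 c); apply: cvgM sto0; exact: cvg_cst.
(* The constant [eps / (K * Tb)] comes from dividing the drift of S by K in [Sdrift], then by the
   monotonicity constant Tb of F. *)
apply: (@cvg_lt_controlled R V q l e s (eps / (K * Tb)) B (Num.sqrt N%:R) eps) => //.
- exact: (divr_ge0 (ltW eps_gt0) (mulr_ge0 K_ge0 (ltW Tb_gt0))).
- by rewrite VE.
- exact: cvg_scale.
- move=> m k mk; rewrite /q (le_trans (enorm_dist _ _))//.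
  rewrite opprB addrA subrK.
  have h1 := Fmono _ _ (Hx m i0) (Hx k i0).
  have h2 : enorm (F (x k i0) - F (x m i0)) <=
      enorm (S k - S m) + T * s m + T * s k.
    have split4 (y z u v : 'rV[R]_n) : y - z = (u - v) - (z - v) + (y - u).
      by rewrite opprB (subrKA v) [RHS]addrC (subrKA u).
    rewrite (split4 _ _ (S k) (S m)).
    rewrite (le_trans (enormD _ _))// lerD ?FS//.
    by rewrite (le_trans (enormD _ _))// enormN lerD ?FS.
  have h3 := Sdrift m k mk.
  rewrite -(ler_pM2l Tb_gt0); apply: (le_trans h1); apply: (le_trans h2).
  have h4 : enorm (S k - S m) <= eps / K * (V m - V k).
    by rewrite mulrAC ler_pdivlMr// mulrC.
  rewrite /e (_ : Tb * _ = eps / K * (V m - V k) + T * s m + T * s k).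
    by rewrite !lerD.
  by field; rewrite !gt_eqF.
- move=> k; rewrite /q -enorm_stack_const (le_trans (enorm_dist _ _))// !stackB.
  rewrite (le_trans (enorm_stack_le _))// ler_sum// => i _.
  by rewrite opprB addrA subrK.
(* Here the starting point matters: S vanishes at 0 and F at [xs], so the distance to x* is
   controlled by the total drift of S since time 0. *)
- move=> k; have h1 := Fmono _ _ Hxs (Hx k i0); rewrite Fxs subr0 in h1.
  have h2 : enorm (F (x k i0)) <= enorm (S k) + T * s k.
    by rewrite -[F _](subrK (S k)) addrC (le_trans (enormD _ _))// lerD.
  have h3 := Sdrift 0%N k (leq0n k); rewrite S0 subr0 in h3.
  have h4 : enorm (S k) <= eps / K * (V 0%N - V k).
    by rewrite mulrAC ler_pdivlMr// mulrC.
  have : q k <= (eps / K * (V 0%N - V k) + T * s k) / Tb.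
    rewrite ler_pdivlMr// [leLHS]mulrC (le_trans h1)// (le_trans h2)//.
    by rewrite lerD2r.
  (* By the choice of K, the square root of N divided by [K * Tb] is exactly [1 / V0]. *)
  move=> /(ler_wpM2l (ltW sqrtN_gt0)) /le_trans; apply.
  rewrite le_eqVlt; apply/orP; left; apply/eqP.
  by rewrite /e /K VE; field; rewrite !gt_eqF.
Qed.
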